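(* Assume $u_0(\boldsymbol{x})\ge 0$ and $g(\boldsymbol{x},t)\ge 0$ for all $\boldsymbol{x}$ and $t$. Let $(\boldsymbol{u}^n)_{n\ge 0}$ be generated by the hybrid explicit-implicit scheme (HEIM I) $$(M-\Delta t_n B+\Delta t_n A)\,\boldsymbol{u}^{n+1} = M\,\boldsymbol{u}^{n}+\Delta t_n\,\boldsymbol{g}^{n+1},\qquad n=0,1,\ldots,$$ where $B=(b_{ij})$ is the $N_v\times N_v$ matrix (depending on $n$) with $b_{ij}=\int_\Omega f(u_h^n)\,\phi_j\phi_i\,d\boldsymbol{x}$ for $i=1,\ldots,N_{vi}$ and $b_{ij}=0$ for $i=N_{vi}+1,\ldots,N_v$ ($j=1,\ldots,N_v$). Suppose that for all $n=0,1,\ldots$ the mesh satisfies $$\mathbb{D}_{acute}>\left(\frac{|\Omega|}{N_e}\right)^{2/d}\frac{\max_{\boldsymbol{x}}\left|f^{-}(u_h^n)\right|}{(d+1)(d+2)}$$ and the time step satisfies $$\frac{\left(\frac{|\Omega|}{N_e}\right)^{2/d}}{(d+1)(d+2)\,\mathbb{D}_{acute}-\left(\frac{|\Omega|}{N_e}\right)^{2/d}\max_{\boldsymbol{x}}\left|f^{-}(u_h^n)\right|}\ \le\ \Delta t_n\ <\ \frac{1}{\max_{\boldsymbol{x}}f^{+}(u_h^n)}.$$ Then the scheme preserves nonnegativity: $u_j^n\ge 0$ for all $j=1,\ldots,N_v$ and all $n\ge 0$ (equivalently, $u_h^n\ge 0$ on $\Omega$ for all $n\ge 0$).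
   Context: Continuous problem: $\partial_t u-\nabla\cdot(\mathbb{D}\nabla u)=u f(u)$ in $\Omega\times(0,T]$, $u=g$ on $\partial\Omega\times(0,T]$, $u(\cdot,0)=u_0$ in $\Omega$. Here $d\in\{1,2,3\}$, $\Omega\subset\mathbb{R}^d$ is a connected bounded polygonal or polyhedral domain, $T>0$; the diffusion tensor $\mathbb{D}=\mathbb{D}(\boldsymbol{x})$ is a $d\times d$ matrix function that is continuous (and integrable over $\Omega$), symmetric and uniformly positive definite on $\Omega$; $f:\mathbb{R}\to\mathbb{R}$ is such that $f$ and $f'$ exist, are continuous, and are bounded for all bounded $u$; $u_0$ and $g$ are given functions (with $u_0$ defined at all mesh vertices). Mesh: $\mathcal{T}_h$ is a (conforming) simplicial triangulation of $\Omega$ with $N_e$ elements, $N_v$ vertices $\boldsymbol{x}_1,\ldots,\boldsymbol{x}_{N_v}$, of which the first $N_{vi}$ are the interior vertices (not on $\partial\Omega$). $\phi_j$ is the continuous piecewise linear basis function with $\phi_j(\boldsymbol{x}_i)=\delta_{ij}$. $|K|$ and $|\Omega|$ denote volumes; $\mathbb{D}_K$ is the average of $\mathbb{D}$ over $K\in\mathcal{T}_h$. Matrices: $M=(m_{ij})$ with $m_{ij}=\int_\Omega\phi_j\phi_i\,d\boldsymbol{x}$ for $i\le N_{vi}$ and $m_{ij}=0$ for $i>N_{vi}$; $A=(a_{ij})$ with $a_{ij}=\int_\Omega(\nabla\phi_i)^T\mathbb{D}\nabla\phi_j\,d\boldsymbol{x}=\sum_{K\in\mathcal{T}_h}|K|(\nabla\phi_i)^T\mathbb{D}_K\nabla\phi_j$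 (gradients taken on $K$) for $i\le N_{vi}$ and $a_{ij}=\delta_{ij}$ for $i>N_{vi}$ ($j=1,\ldots,N_v$). Time levels: $0=t_0<t_1<\cdots$ in $[0,T]$, $\Delta t_n=t_{n+1}-t_n$. The vector $\boldsymbol{u}^n=(u_1^n,\ldots,u_{N_v}^n)^T$ contains the nodal values of $u_h^n=\sum_{j=1}^{N_v}u_j^n\phi_j$, with initial vector $u_j^0=u_0(\boldsymbol{x}_j)$. $\boldsymbol{g}^{n+1}$ has entries $0$ for $i\le N_{vi}$ and $g(\boldsymbol{x}_i,t_{n+1})$ for $i>N_{vi}$. Mesh quantity: for each $K\in\mathcal{T}_h$ let $\phi_0,\ldots,\phi_d$ denote (local numbering) the linear basis functions on $K$ of its $d+1$ vertices, and set $$\mathbb{D}_{acute}=\left(\frac{|\Omega|}{N_e}\right)^{2/d}\min_{K\in\mathcal{T}_h}\ \min_{i,j=0,\ldots,d,\ i\ne j}\left(-(\nabla\phi_i)^T\mathbb{D}_K\nabla\phi_j\right).$$ Notation: $v^+=\max\{v,0\}$, $v^-=\min\{v,0\}$; $\max_{\boldsymbol{x}}$ is the maximum over $\overline{\Omega}$. A fraction with positive numerator and zero denominator is read as $+\infty$. *)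

(* Defs.v *)
From HB Require Import structures.
From mathcomp Require Import all_boot all_order all_algebra.
From mathcomp Require Import all_classical all_reals all_analysis.

Set Implicit Arguments.
Unset Strict Implicit.
Unset Printing Implicit Defensive.

Import Order.TTheory GRing.Theory Num.Theory.
Import numFieldNormedType.Exports.

Local Open Scope classical_set_scope.
Local Open Scope ring_scope.

(* The library equips tuples (but not row vectors) with the product
   sigma-algebra, so Lebesgue measure on R^n is built on n.-tuple R by iterated
   products and carried over to 'rV[R]_n through the coordinates. *)
Section LebesgueRn.
Variable R : realType.
Local Notation mR := (measurableTypeR R).

Definition tcons n (p : n.-tuple mR * mR) : n.+1.-tuple mR :=
  [the n.+1.-tuple mR of p.2 :: p.1].

Lemma measurable_tcons n : measurable_fun [set: n.-tuple mR * mR] (@tcons n).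
Proof. exact: (measurable_cons measurable_snd measurable_fst). Qed.

(* The measure structure of pushforward depends on a measurability proof that
   unification cannot infer, hence the explicit instance below. *)
Fixpoint leb (n : nat) : {measure set (n.-tuple mR) -> \bar R} :=
  match n return {measure set (n.-tuple mR) -> \bar R} with
  | 0 => \d_([tuple] : 0.-tuple mR)
  | m.+1 => measure_function_pushforward__canonical__measure_function_Measure
      (leb m \x @lebesgue_measure R)%E
      (@measurable_tcons m)
  end.

Definition rowt n (t : n.-tuple mR) : 'rV[R]_n := \row_i tnth t i.

Definition vol n (A : set 'rV[R]_n) : R := fine (leb n (@rowt n @^-1` A)).

Definition integral_Rn n (A : set 'rV[R]_n) (F : 'rV[R]_n -> R) : R :=
  \int[leb n]_(t in @rowt n @^-1` A) F (rowt t).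

Definition integrable_Rn n (A : set 'rV[R]_n) (F : 'rV[R]_n -> R) : Prop :=
  (leb n).-integrable (@rowt n @^-1` A) (fun t => (F (rowt t))%:E).

End LebesgueRn.

Section Geometry.
Variables (R : realType) (d : nat).
Implicit Types (Omega A : set 'rV[R]_d).

Definition boundary A : set 'rV[R]_d := closure A `\` interior A.

Definition hull (I : finType) (x : I -> 'rV[R]_d) (S : {set I}) :
    set 'rV[R]_d :=
  [set y | exists a : I -> R, [/\ forall i, i \in S -> 0 <= a i,
     \sum_(i in S) a i = 1 & y = \sum_(i in S) a i *: x i]].

Definition affinely_independent (I : finType) (x : I -> 'rV[R]_d)
    (S : {set I}) : Prop :=
  forall a : I -> R, \sum_(i in S) a i = 0 -> \sum_(i in S) a i *: x i = 0 ->
  forall i, i \in S -> a i = 0.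

(* Bounded domain whose boundary is a finite union of (d-1)-simplices: points
   (d = 1), segments (d = 2), triangles (d = 3). *)
Definition polyhedral_domain Omega : Prop :=
  [/\ open Omega, Omega !=set0, connected Omega, bounded_set Omega &
   exists n, exists F : 'I_n -> 'I_d -> 'rV[R]_d,
     (forall k, affinely_independent (F k) [set: 'I_d]) /\
     boundary Omega = \bigcup_(k in [set: 'I_n]) hull (F k) [set: 'I_d] ].

Definition grad (F : 'rV[R]_d -> R) (x : 'rV[R]_d) : 'cV[R]_d :=
  \col_k 'D_(delta_mx 0 k) F x.

(* An element is the set of indices of its d+1 vertices. *)
Record mesh := Mesh {
  nvert : nat;
  nvint : nat;
  vertex : 'I_nvert -> 'rV[R]_d;
  elements : {set {set 'I_nvert}} }.

Definition nelem (T : mesh) : nat := #|elements T|.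

Definition simplex (T : mesh) (K : {set 'I_(nvert T)}) : set 'rV[R]_d :=
  hull (@vertex T) K.

(* The empty set of vertices has an empty hull, so tri_conforming says that two
   elements meet in a common face or not at all. *)
Record triangulation Omega (T : mesh) : Prop := Triangulation {
  tri_inj : injective (@vertex T);
  tri_card : forall K, K \in elements T -> #|K| = d.+1;
  tri_indep : forall K, K \in elements T ->
    affinely_independent (@vertex T) K;
  tri_used : forall i, exists2 K, K \in elements T & i \in K;
  tri_cover : closure Omega = \bigcup_(K in [set` elements T]) simplex K;
  tri_interior : forall K, K \in elements T -> interior (simplex K) `<=` Omega;
  tri_conforming : forall K L, K \in elements T -> L \in elements T ->
    simplex K `&` simplex L = simplex (K :&: L);
  tri_nvint : (nvint T <= nvert T)%N;
  tri_numbering : forall i : 'I_(nvert T),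
    (i < nvint T)%N <-> ~ boundary Omega (vertex i) }.

Definition nodal_basis Omega (T : mesh)
    (phi : 'I_(nvert T) -> 'rV[R]_d -> R) : Prop :=
  [/\ forall j, {within closure Omega, continuous (phi j)},
      forall j K, K \in elements T -> exists (p : 'cV[R]_d) (c : R),
        forall x, simplex K x -> phi j x = (x *m p) 0 0 + c &
      forall i j, phi j (vertex i) = (i == j)%:R].

End Geometry.

Arguments vertex {R d} _ _.

Section Problem.
Variable R : realType.

Definition diffusion_tensor d (Omega : set 'rV[R]_d) (D : 'rV[R]_d -> 'M[R]_d) :
    Prop :=
  [/\ {within Omega, continuous D},
      forall k l, integrable_Rn Omega (fun x => D x k l),
      forall x, Omega x -> (D x)^T = D x &
      exists2 alpha : R, 0 < alpha & forall x, Omega x ->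
        forall xi : 'cV[R]_d,
          alpha * (xi^T *m xi) 0 0 <= (xi^T *m D x *m xi) 0 0].

Definition reaction (f : R -> R) : Prop :=
  [/\ forall v, derivable f v 1, continuous f, continuous (f^`())%classic &
      forall b : R, exists c : R, forall v, `|v| <= b ->
        `|f v| <= c /\ `|(f^`())%classic v| <= c].

End Problem.

Section FiniteElements.
Variables (R : realType) (d : nat) (Omega : set 'rV[R]_d) (T : mesh R d).
Variable (phi : 'I_(nvert T) -> 'rV[R]_d -> R).
Local Notation Nv := (nvert T).

Definition fe_fun (v : 'cV[R]_Nv) (x : 'rV[R]_d) : R :=
  \sum_j v j 0 * phi j x.

Definition mass_mx : 'M[R]_Nv :=
  \matrix_(i, j) if (i < nvint T)%N
                 then integral_Rn Omega (fun x => phi j x * phi i x) else 0.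

(* The gradients exist off the faces of the mesh, hence almost everywhere. *)
Definition stiffness_mx (D : 'rV[R]_d -> 'M[R]_d) : 'M[R]_Nv :=
  \matrix_(i, j) if (i < nvint T)%N
    then integral_Rn Omega
           (fun x => ((grad (phi i) x)^T *m D x *m grad (phi j) x) 0 0)
    else (i == j)%:R.

Definition reaction_mx (f : R -> R) (v : 'cV[R]_Nv) : 'M[R]_Nv :=
  \matrix_(i, j) if (i < nvint T)%N
    then integral_Rn Omega (fun x => f (fe_fun v x) * phi j x * phi i x)
    else 0.

Definition boundary_vec (g : 'rV[R]_d -> R -> R) (s : R) : 'cV[R]_Nv :=
  \col_i if (i < nvint T)%N then 0 else g (vertex T i) s.

(* D is only given on Omega; the part of K outside Omega lies on faces of K and
   has measure zero. *)
Definition tensor_avg (D : 'rV[R]_d -> 'M[R]_d) (K : {set 'I_Nv}) : 'M[R]_d :=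
  \matrix_(k, l) ((vol (simplex K))^-1 *
                  integral_Rn (simplex K `&` Omega) (fun x => D x k l)).

(* The gradient of phi i is constant in the interior of K; it is read off at
   the barycentre of K. *)
Definition elem_grad (K : {set 'I_Nv}) (i : 'I_Nv) : 'cV[R]_d :=
  grad (phi i) (d.+1%:R^-1 *: \sum_(j in K) vertex T j).

Definition mesh_scale : R := (vol Omega / (nelem T)%:R) `^ (2 / d%:R).

(* The infimum ranges over a finite set, nonempty if d >= 1 and T has an
   element, so it is a minimum. *)
Definition D_acute (D : 'rV[R]_d -> 'M[R]_d) : R :=
  mesh_scale * inf [set r | exists K i j,
    [/\ K \in elements T, i \in K, j \in K, i != j &
        r = - ((elem_grad K i)^T *m tensor_avg D K *m elem_grad K j) 0 0]].

(* Suprema over a compact set of continuous functions, hence maxima. *)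
Definition max_fneg (f : R -> R) (v : 'cV[R]_Nv) : R :=
  sup [set `|Num.min (f (fe_fun v x)) 0| | x in closure Omega].

Definition max_fpos (f : R -> R) (v : 'cV[R]_Nv) : R :=
  sup [set Num.max (f (fe_fun v x)) 0 | x in closure Omega].

End FiniteElements.

(* Main.v *)
(* Let A_n = M - dt B + dt A and let z be the negative part of u^{n+1}. If the
   interior rows of A_n have nonpositive off-diagonal entries and z^T A_n z > 0
   for z <> 0 supported at interior vertices, then testing the scheme with z
   gives z^T A_n z <= z^T A_n u^{n+1} = z^T M u^n <= 0, hence z = 0.
   Positivity comes from 1 - dt f(u_h^n) > 0 and from the ellipticity of D.
   The sign of the off-diagonal entries comes from the mesh and time step
   conditions, through the bound (d+1)(d+2) int_K phi_i phi_j <= |K|.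

   That bound is obtained without a linear change of variables. Let h be the
   homothety of ratio r < 1 centred at the vertex i of K, and let G >= 0 satisfy
   G o h = r^k G. Outside h(K) the barycentric coordinate phi_i is at most 1 - r,
   and on h(K) it is 1 - r plus r phi_i o h^-1, so
     int_K phi_i G <= (1 - r) int_K G + r^(d+k+1) int_K phi_i G.
   Letting r tend to 1 gives (d+k+1) int_K phi_i G <= int_K G, which is applied
   to G = phi_j and then to G = 1. *)

Require Import Defs.
From HB Require Import structures.
From mathcomp Require Import all_boot all_order all_algebra.
From mathcomp Require Import all_classical all_reals all_analysis.
From mathcomp Require Import measurable_realfun ring lra.

Set Implicit Arguments.
Unset Strict Implicit.
Unset Printing Implicit Defensive.

Import Order.TTheory GRing.Theory Num.Theory.
Import numFieldNormedType.Exports.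

Local Open Scope classical_set_scope.
Local Open Scope ring_scope.

(** * Lebesgue measure on R^n *)

Lemma measurable_affineR (R : realType) (r b : R) :
  measurable_fun [set: measurableTypeR R]
    (fun y : measurableTypeR R => b + r * y : measurableTypeR R).
Proof.
apply: measurable_funD; first exact: measurable_cst.
by apply: measurable_funM => //; exact: measurable_cst.
Qed.

(** By uniqueness of Lebesgue measure: [r] times its pushforward under the affine map gives every
    half-open interval its length. *)
Lemma lebesgue_measure_affine (R : realType) (r b : R) (A : set R) :
  0 < r -> measurable A ->
  lebesgue_measure ((fun y => b + r * y) @^-1` A) =
  ((r^-1)%:E * lebesgue_measure A)%E.
Proof.
move=> r0 mA.
pose h := (fun y : measurableTypeR R => b + r * y : measurableTypeR R).
have mh : measurable_fun setT h by exact: measurable_affineR.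
pose nr : {nonneg R} := NngNum (ltW r0).
pose m := mscale nr
  (measure_function_pushforward__canonical__measure_function_Measure
    lebesgue_measure mh).
have mE X : m X = (r%:E * lebesgue_measure (h @^-1` X))%E by [].
rewrite [in RHS](@lebesgue_measure_unique R m) => [|X [[u v] _ <-]|//]; last first.
  rewrite [RHS](mE _) /=.
  have ->  : h @^-1` `]u, v] = `](u - b) / r, (v - b) / r]%classic.
    apply/seteqP; split => y /=; rewrite !in_itv /= ltr_pdivrMr// ler_pdivlMr//;
      by rewrite ltrBlDl lerBrDl mulrC.
  rewrite !lebesgue_measure_itv /= !lte_fin ltr_pM2r ?invr_gt0// ltrD2r.
  case: ifPn => uv; last by rewrite mule0.
  rewrite -!EFinB -EFinM; congr EFin; field; exact: lt0r_neq0.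
rewrite [X in (_ * X)%E](mE _) muleA -EFinM mulVf ?mul1e//.
exact: lt0r_neq0.
Qed.

Section leb.
Variable R : realType.
Local Notation mR := (measurableTypeR R).

Lemma lebS n (A : set (n.+1.-tuple mR)) :
  leb R n.+1 A =
  (\int[leb R n]_x lebesgue_measure (xsection ((@tcons R n) @^-1` A) x))%E.
Proof. by []. Qed.

(** With [b k = (1 - r) * x k] this is the homothety of ratio [r] centred at [x]. *)
Definition homothety n (r : R) (b : 'I_n -> R) (t : n.-tuple mR) : n.-tuple mR :=
  [tuple (b i + r * tnth t i : mR) | i < n].

Lemma measurable_homothety n (r : R) (b : 'I_n -> R) :
  measurable_fun setT (@homothety n r b).
Proof.
apply/measurable_fun_tnthP => i.
rewrite (_ : _ \o _ = (fun y : mR => b i + r * y : mR) \o (@tnth _ mR ^~ i)).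
  apply: measurableT_comp; first exact: measurable_affineR.
  exact: measurable_tnth.
by apply/funext => t /=; rewrite tnth_mktuple.
Qed.

Lemma homothety_tcons n r b (p : n.-tuple mR * mR) :
  homothety r b (tcons p) =
  tcons (homothety r (fun i => b (lift ord0 i)) p.1, b ord0 + r * p.2).
Proof.
case: p => x y; apply: eq_from_tnth => i; rewrite tnth_mktuple /tcons /=.
case: (unliftP ord0 i) => [j|] ->; last by rewrite !tnth0.
by rewrite !tnthS tnth_mktuple.
Qed.

(** Induction on the dimension: each one-dimensional section contributes a factor [r^-1], and the
    integral over the remaining coordinates contributes [r^-n]. *)
Lemma leb_homothety n (r : R) b (A : set (n.-tuple mR)) : 0 < r -> measurable A ->
  leb R n (homothety r b @^-1` A) = ((r ^- n)%:E * leb R n A)%E.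
Proof.
move=> r0; elim: n b A => [|n IH] b A mA.
  rewrite expr0 invr1 mul1e; congr (leb R 0 _).
  by apply/funext => t; rewrite /preimage /= [homothety _ _ _]tuple0 [t]tuple0.
pose b' i := b (lift ord0 i).
pose A' := @tcons R n @^-1` A.
have mA' : measurable A'.
  by rewrite -[A']setTI; exact: (@measurable_tcons R n).
pose G x := lebesgue_measure (xsection A' x).
have mG : measurable_fun setT G by exact: measurable_fun_xsection.
pose nu := (measure_function_pushforward__canonical__measure_function_Measure
      (leb R n) (@measurable_homothety n r b')).
rewrite !lebS.
transitivity (\int[leb R n]_x ((r^-1)%:E * G (homothety r b' x)))%E.
  apply: eq_integral => x _;
  rewrite -(@lebesgue_measure_affine R r (b ord0))//; last first.
    exact: measurable_xsection.
  rewrite (_ : xsection (_ @^-1` (homothety r b @^-1` A)) x =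
    (fun y => b ord0 + r * y) @^-1` xsection A' (homothety r b' x))//.
  apply/seteqP; split => y; rewrite /xsection /= !inE /= /A' /preimage /=;
    by rewrite homothety_tcons.
rewrite ge0_integralZl//; last 2 first.
- by apply: measurableT_comp => //; exact: measurable_homothety.
- by rewrite lee_fin invr_ge0 ltW.
transitivity ((r^-1)%:E * \int[nu]_x G x)%E.
  by rewrite (@ge0_integral_pushforward _ _ _ _ _ _ (@measurable_homothety n r b')).
have rn0 : r ^- n >= 0 by rewrite invr_ge0 exprn_ge0// ltW.
(* The induction hypothesis identifies the pushforward [nu] with [r^-n] times [leb R n], set by
   set. *)
have -> : (\int[nu]_x G x = \int[mscale (NngNum rn0) (leb R n)]_x G x)%E.
  apply: eq_measure_integral => B mB _; exact: IH.
rewrite ge0_integral_mscale//= muleA -EFinM; congr (_%:E * _)%E.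
by rewrite exprS invfM.
Qed.

(** * Affine functions, null hyperplanes, cubes and open sets *)

Definition aff n (p : 'cV[R]_n) (c : R) (x : 'rV[R]_n) : R := (x *m p) 0 0 + c.

Lemma aff_rowt n (p : 'cV[R]_n) c (t : n.-tuple mR) :
  aff p c (rowt t) = \sum_i tnth t i * p i 0 + c.
Proof.
by rewrite /aff mxE; congr (_ + _); apply: eq_bigr => i _; rewrite mxE.
Qed.

Lemma measurable_aff n (p : 'cV[R]_n) c :
  measurable_fun setT (fun t : n.-tuple mR => aff p c (rowt t)).
Proof.
under eq_fun do rewrite aff_rowt.
apply: measurable_funD; last exact: measurable_cst.
apply: measurable_sum => i; apply: measurable_funM; last exact: measurable_cst.
exact: measurable_tnth.
Qed.

Lemma aff_tcons n (p : 'cV[R]_n.+1) c (q : n.-tuple mR * mR) :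
  aff p c (rowt (tcons q)) =
  q.2 * p ord0 0 + aff (\col_i p (lift ord0 i) 0) c (rowt q.1).
Proof.
rewrite !aff_rowt big_ord_recl /tcons /= tnth0 -addrA; congr (_ + (_ + _)).
by apply: eq_bigr => i _; rewrite tnthS mxE.
Qed.

Lemma measurable_aff0 n (p : 'cV[R]_n) c :
  measurable [set t : n.-tuple mR | aff p c (rowt t) = 0].
Proof.
rewrite (_ : mkset _ = (fun t => aff p c (rowt t)) @^-1` [set 0])//.
rewrite -[X in measurable X]setTI; exact: measurable_aff.
Qed.

(** Induction on the dimension: if the first slope is nonzero, every section of the zero set is a
    single point; otherwise the zero set is a cylinder over one of lower dimension. A point where
    the function is nonzero excludes the zero function. *)
Lemma leb_aff0 n (p : 'cV[R]_n) c (x : 'rV[R]_n) : aff p c x != 0 ->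
  leb R n [set t | aff p c (rowt t) = 0] = 0.
Proof.
elim: n p c x => [|n IH] p c x px.
  rewrite (_ : mkset _ = set0) ?measure0//.
  apply/seteqP; split => // t /=; rewrite aff_rowt big_ord0.
  by move: px; rewrite /aff mxE big_ord0 => /eqP.
pose p' : 'cV[R]_n := \col_i p (lift ord0 i) 0.
have [p0|p0] := eqVneq (p ord0 0) 0; last first.
  rewrite lebS; apply: integral0_eq => t _.
  rewrite (_ : xsection _ _ = [set - aff p' c (rowt t) / p ord0 0]).
    exact: lebesgue_measure_set1.
  apply/seteqP; split => y; rewrite /xsection /= inE /preimage /= aff_tcons /=.
    by move/eqP; rewrite addr_eq0 => /eqP <-; rewrite mulfK.
  by move=> ->; rewrite divfK// addNr.
pose N : set (n.-tuple mR) := [set t | aff p' c (rowt t) = 0].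
have E : @tcons R n @^-1` [set t | aff p c (rowt t) = 0] = N `*` setT.
  by apply/seteqP; split => -[t y] /=; rewrite aff_tcons p0 mulr0 add0r//= => -[].
have -> : leb R n.+1 [set t | aff p c (rowt t) = 0] =
    ((leb R n \x @lebesgue_measure R) (N `*` setT))%E.
  by rewrite -E.
rewrite product_measure1E//; last exact: measurable_aff0.
rewrite (IH p' c (\row_i x 0 (lift ord0 i))) ?mul0e//.
move: px; rewrite /aff !mxE big_ord_recl p0 mulr0 add0r.
by under [in X in _ -> X]eq_bigr do rewrite !mxE.
Qed.

Definition cube n (a : 'I_n -> R) (e : R) : set (n.-tuple mR) :=
  [set t | forall i, ball (a i) e (tnth t i)].

Lemma measurable_cube n (a : 'I_n -> R) e : measurable (cube a e).
Proof.
rewrite (_ : cube a e =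
    \bigcap_(i in [set: 'I_n]) ((@tnth _ mR ^~ i) @^-1` ball (a i) e)).
  apply: fin_bigcap_measurable => // i _.
  rewrite -[X in measurable X]setTI; apply: measurable_tnth => //.
  exact: measurable_ball.
by apply/seteqP; split => t /= ti i; [move=> _|]; apply: ti.
Qed.

Lemma leb_cube n (a : 'I_n -> R) e : 0 <= e ->
  leb R n (cube a e) = ((e *+ 2) ^+ n)%:E.
Proof.
move=> e0; elim: n a => [|n IH] a.
  rewrite expr0 /= diracE mem_set//; by case.
have E : @tcons R n @^-1` (cube a e) =
    cube (fun i => a (lift ord0 i)) e `*` ball (a ord0) e.
  apply/seteqP; split => -[t y] /=.
    move=> H; split; last by have := H ord0; rewrite /tcons tnth0.
    by move=> i; have := H (lift ord0 i); rewrite /tcons tnthS.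
  move=> [H1 H2] i; case: (unliftP ord0 i) => [j|] ->.
    by rewrite tnthS; exact: H1.
  by rewrite tnth0.
have -> : leb R n.+1 (cube a e) = ((leb R n \x @lebesgue_measure R)
    (cube (fun i => a (lift ord0 i)) e `*` ball (a ord0) e))%E.
  by rewrite -E.
rewrite product_measure1E//; last 2 first.
- exact: measurable_cube.
- exact: measurable_ball.
by rewrite IH [X in (_ * X)%E]lebesgue_measure_ball// -EFinM exprSr.
Qed.

Lemma ball_rowt n (x : 'rV[R]_n) e : 0 < e ->
  @rowt R n @^-1` ball x e = cube (x 0) e.
Proof.
move=> e0; apply/seteqP; split => t.
  by move=> [_ /= H] i; have := H 0 i; rewrite mxE.
by move=> H; split => // i j; rewrite ord1 mxE; exact: H.
Qed.

(** An open set is the union of the balls it contains with rational centre and radius [1 / (k + 1)].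
    There are countably many, and each is a cube of the product sigma-algebra. *)
Lemma measurable_open n (A : set 'rV[R]_n) : open A ->
  measurable (@rowt R n @^-1` A).
Proof.
move=> oA.
pose Q := ('rV[rat]_n * nat)%type.
pose c (q : Q) : 'rV[R]_n := map_mx ratr q.1.
pose e (q : Q) : R := q.2.+1%:R^-1.
have e0 q : 0 < e q by rewrite invr_gt0.
have -> : A = \bigcup_(q in [set: Q])
    [set x | ball (c q) (e q) x /\ ball (c q) (e q) `<=` A].
  apply/seteqP; split => [x Ax|x [q _ [qx +]]]; last exact.
  have /nbhs_ballP[r /= r0 rA] := open_nbhs_nbhs (conj oA Ax).
  (* The radius is below [r / 2] because the chosen ball contains [x] without being centred there:
     its points are within two radii of [x]. *)
  have [k kr] : exists k : nat, k.+1%:R^-1 < r / 2.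
    have r20 : 0 < r / 2 by rewrite divr_gt0.
    have [k _ /(_ k (leqnn k)) /=] := near_infty_natSinv_lt (PosNum r20).
    by exists k.
  have /choice[q qx] : forall i, exists q : rat,
      ratr q \in `](x 0 i - k.+1%:R^-1), (x 0 i + k.+1%:R^-1)[.
    by move=> i; apply: rat_in_itvoo; rewrite ltrD2l gtrN// invr_gt0.
  have qxk : ball (\row_i ratr (q i) : 'rV[R]_n) k.+1%:R^-1 x.
    split=> [|i j]; first by rewrite invr_gt0.
    rewrite ord1 mxE ball_itv /= in_itv /=; have := qx j.
    by rewrite in_itv /= !ltrBlDr andbC.
  exists (\row_i q i, k) => //=; rewrite /c /e /=.
  have -> : map_mx ratr (\row_i q i) = \row_i ratr (q i) :> 'rV[R]_n.
    by apply/rowP => i; rewrite !mxE.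
  split=> // y qy; apply: rA; apply: (@le_ball _ _ _ (k.+1%:R^-1 + k.+1%:R^-1)).
    by rewrite [leRHS]splitr lerD// ltW.
  by apply: ball_triangle qy; exact: ball_sym.
rewrite preimage_bigcup; apply: countable_bigcupT_measurable => [|q].
  exact: countableP.
have [qA|qA] := pselect (ball (c q) (e q) `<=` A).
  rewrite (_ : _ @^-1` _ = @rowt R n @^-1` (ball (c q) (e q))).
    by rewrite ball_rowt//; exact: measurable_cube.
  by apply/seteqP; split => t //= [].
rewrite (_ : _ @^-1` _ = set0)//.
by apply/seteqP; split => t //= [].
Qed.

Import HBNNSimple.

(* No measurability of A or F is required: gradients of basis functions have
   unspecified values on the faces of the mesh. *)
Lemma integral_setD_null d (X : measurableType d) (mu : {measure set X -> \bar R})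
    (A N : set X) (F : X -> \bar R) : measurable N -> mu N = 0%E ->
  (\int[mu]_(x in A) F x = \int[mu]_(x in A `\` N) F x)%E.
Proof.
move=> mN N0.
suff key (G : X -> \bar R) : (forall x, 0 <= G x)%E ->
    (\int[mu]_(x in A) G x = \int[mu]_(x in A `\` N) G x)%E.
  by rewrite integralE [RHS]integralE; congr (_ - _)%E; exact: key.
move=> G0; rewrite integral_mkcond [RHS]integral_mkcond.
have h0 (B : set X) x : (0 <= (G \_ B) x)%E by rewrite erestrict_ge0.
rewrite !ge0_integralTE//; apply/eqP; rewrite eq_le; apply/andP; split; last first.
  apply: le_ereal_sup => _ [h /= hG <-]; exists h => // x.
  apply: le_trans (hG x) _; rewrite !patchE.
  case: ifPn => xA; case: ifPn => // xB.
  by move: xA xB; rewrite in_setD => /andP[->].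
apply: ge_ereal_sup => _ [h /= hG <-]; apply: ereal_sup_ubound.
(* Cutting [h] to the complement of [N] keeps it simple, since [N] is measurable, and keeps its
   integral, since [N] is null. *)
exists (proj_nnsfun h (measurableC mN)).
  move=> x; rewrite -mrestrict !patchE.
  case: ifPn => xN; last by case: ifPn => //= _; exact: G0.
  have := hG x; rewrite patchE; case: ifPn => xA hx.
    by rewrite ifT// in_setD xA -in_setC.
  by rewrite ifF//; apply/negbTE; rewrite in_setD negb_and xA.
rewrite -mrestrict -integral_nnsfun//; last exact: measurableC.
rewrite -integralT_nnsfun (@ge0_negligible_integral _ _ _ mu setT N)//.
- by rewrite setTD.
- exact/measurable_EFinP.
- by move=> x _; rewrite lee_fin.
Qed.
End leb.

(** * Integrals over a simplex *)

Section simplex.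
Variables (R : realType) (n : nat).
Local Notation mR := (measurableTypeR R).

Lemma continuous_aff (p : 'cV[R]_n) c : continuous (aff p c).
Proof.
have -> : aff p c = (fun x => (\sum_i x 0 i * p i 0) + c).
  by apply/funext => x; rewrite /aff mxE.
have cS (s : seq 'I_n) : continuous (fun x : 'rV[R]_n => \sum_(i <- s) x 0 i * p i 0).
  elim: s => [|i s IH] x.
    under eq_fun do rewrite big_nil.
    exact: cst_continuous.
  under eq_fun do rewrite big_cons.
  apply: (@continuousD _ _ _ (fun x : 'rV[R]_n => x 0 i * p i 0)); last exact: IH.
  apply: (@continuousM _ _ (fun x : 'rV[R]_n => x 0 i)).
    exact: coord_continuous.
  exact: cst_continuous.
move=> x; apply: (@continuousD _ _ _ (fun x : 'rV[R]_n => \sum_i x 0 i * p i 0)).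
  exact: cS.
exact: cst_continuous.
Qed.

Lemma leb_open_gt0 (A : set 'rV[R]_n) : open A -> A !=set0 ->
  (0 < leb R n (@rowt R n @^-1` A))%E.
Proof.
move=> oA [x Ax].
have /nbhs_ballP[e /= e0 eA] := open_nbhs_nbhs (conj oA Ax).
apply: (@lt_le_trans _ _ (leb R n (cube (x 0) e))).
  by rewrite leb_cube ?ltW// lte_fin exprn_gt0// pmulrn_rgt0.
apply: le_measure; rewrite ?inE; first exact: measurable_cube.
  exact: measurable_open.
by rewrite -ball_rowt// => t /eA.
Qed.

(** Moving the power to the left and dividing by [1 - r] gives [(1 + r + ... + r^m) j <= i]; then
    [r] tends to 1. The limit is explicit: for [r = 1 - e], Bernoulli's inequality bounds each term
    of the sum below by [1 - m e]. *)
Lemma mean_power_le (m : nat) (i j : R) : 0 <= j ->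
  (forall r, 0 < r < 1 -> j <= (1 - r) * i + r ^+ m.+1 * j) ->
  m.+1%:R * j <= i.
Proof.
move=> j0 H.
have bern (e : R) k : 0 < e < 1 -> 1 - k%:R * e <= (1 - e) ^+ k.
  move=> /andP[e0 e1]; elim: k => [|k IH]; first by rewrite mul0r subr0 expr0.
  rewrite exprS; have : (1 - e) * (1 - k%:R * e) <= (1 - e) * (1 - e) ^+ k.
    by rewrite ler_pM2l// subr_gt0.
  apply: le_trans; rewrite -natr1 mulrDl mul1r mulrBr mulr1 mulrBl mul1r.
  have : 0 <= e * (k%:R * e) by rewrite mulr_ge0 ?mulr_ge0// ltW.
  by lra.
have key e : 0 < e < 1 -> m.+1%:R * j <= i + e * (m%:R * m.+1%:R * j).
  move=> /andP[e0 e1].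
  have e01 : 0 < e < 1 by rewrite e0.
  have r01 : 0 < 1 - e < 1 by rewrite subr_gt0 e1/= gtrBl.
  have : (\sum_(k < m.+1) (1 - e) ^+ k) * j <= i.
    have := H _ r01; rewrite opprB addrCA subrr addr0 => He.
    rewrite -(ler_pM2l e0) mulrA.
    have -> : e * (\sum_(k < m.+1) (1 - e) ^+ k) = 1 - (1 - e) ^+ m.+1.
      have := subrX1 (1 - e) m.+1.
      by rewrite (_ : 1 - e - 1 = - e) ?mulNr => [E|]; [rewrite -[RHS]opprB E opprK|ring].
    by rewrite mulrBl mul1r lerBlDr.
  have : \sum_(k < m.+1) (1 - e) ^+ m <= \sum_(k < m.+1) (1 - e) ^+ k.
    apply: ler_sum => k _; apply: ler_wiXn2l; last by rewrite -ltnS.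
      by case/andP: r01 => /ltW.
    by case/andP: r01 => _ /ltW.
  rewrite sumr_const card_ord => h1 h2.
  have h3 : m.+1%:R * (1 - m%:R * e) <= \sum_(k < m.+1) (1 - e) ^+ k.
    by apply: le_trans h1; rewrite -[leRHS]mulr_natl ler_pM2l// bern.
  have := le_trans (ler_wpM2r j0 h3) h2; lra.
apply/ler_addgt0Pr => e e0.
pose C := m%:R * m.+1%:R * j.
have C0 : 0 <= C by rewrite !mulr_ge0.
(* The first bound keeps [d] inside [(0, 1)], the second gives [d * C <= e]; adding 1 to [C] covers
   [C = 0]. *)
pose d := Num.min (1/2) (e / (C + 1)).
have d01 : 0 < d < 1.
  rewrite lt_min divr_gt0// ?divr_gt0 ?ltr_wpDl//= gt_min; apply/orP; left; lra.
apply: (le_trans (key _ d01)); rewrite lerD2l -/C.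
apply: (@le_trans _ _ (e / (C + 1) * C)).
  by rewrite ler_wpM2r// ge_min lexx orbT.
rewrite -mulrA ger_pMr// mulrC ler_pdivrMr ?ltr_wpDl// mul1r lerDl ler01//.
Qed.

Lemma aff_comb (I : finType) (A : {set I}) (a : I -> R) (x : I -> 'rV[R]_n)
    (p : 'cV[R]_n) c : \sum_(i in A) a i = 1 ->
  aff p c (\sum_(i in A) a i *: x i) = \sum_(i in A) a i * aff p c (x i).
Proof.
move=> a1; rewrite /aff mulmx_suml summxE.
under [RHS]eq_bigr do rewrite mulrDr.
rewrite big_split /= -mulr_suml a1 mul1r; congr (_ + _).
by apply: eq_bigr => i _; rewrite -scalemxAl mxE.
Qed.

(** * The open simplex in barycentric coordinates *)

Variables (I : finType) (K : {set I}).
Variables (v : I -> 'rV[R]_n) (p : I -> 'cV[R]_n) (c : I -> R).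
Local Notation lam j := (aff (p j) (c j)).

Definition open_simplex : set 'rV[R]_n := [set x | forall j, j \in K -> 0 < lam j x].

Hypothesis lamv : {in K &, forall i j, lam j (v i) = (i == j)%:R}.
Hypothesis lam1 : forall x, \sum_(j in K) lam j x = 1.
Hypothesis lamx : forall x, \sum_(j in K) lam j x *: v j = x.

Local Notation S := (@rowt R n @^-1` open_simplex).

Lemma open_open_simplex : open open_simplex.
Proof.
rewrite openE => x Kx; change (nbhs (x : 'rV[R]_n) open_simplex).
apply: (@filter_forall _ I (fun j => [set y | j \in K -> 0 < lam j y]) (nbhs x) _).
move=> j; have [jK|_] := boolP (j \in K); last exact: nearW.
have lx : \forall y \near lam j x, 0 < y
    by apply: open_nbhs_nbhs; split; [exact: open_gt|exact: Kx].
have := continuous_aff lx; apply: (@filterS _ (nbhs (x : 'rV[R]_n)) _) => y ly _.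
exact: ly.
Qed.

Lemma measurable_simplex : measurable S.
Proof. by apply: measurable_open; exact: open_open_simplex. Qed.

Lemma lam_le1 x j : open_simplex x -> j \in K -> lam j x <= 1.
Proof.
move=> Kx jK; rewrite -(lam1 x) (bigD1 j)//= lerDl.
by apply: sumr_ge0 => i /andP[iK _]; exact/ltW/Kx.
Qed.

(** A point of the simplex is a combination of the vertices with weights in [[0, 1]], so its
    coordinates are bounded by [M] and it lies in a cube. *)
Lemma leb_simplex_lty : (leb R n S < +oo)%E.
Proof.
pose M := \sum_(j in K) \sum_k `|v j 0 k|.
have M0 : 0 <= M by apply: sumr_ge0 => j _; apply: sumr_ge0.
apply: (@le_lt_trans _ _ (leb R n (cube (fun=> 0) (M + 1)))); last first.
  by rewrite leb_cube ?ltry// addr_ge0.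
apply: le_measure; rewrite ?inE; [exact: measurable_simplex|exact: measurable_cube|].
move=> t Kt k; rewrite -ball_normE /= sub0r normrN.
have -> : tnth t k = \sum_(j in K) lam j (rowt t) * v j 0 k.
  have := lamx (rowt t) => /rowP/(_ k); rewrite mxE => <-.
  by rewrite summxE; apply: eq_bigr => j _; rewrite mxE.
rewrite ltr_pwDr//; apply: le_trans (ler_norm_sum _ _ _) _.
apply: ler_sum => j jK; rewrite normrM.
apply: (@le_trans _ _ `|v j 0 k|).
  by rewrite ler_piMl// gtr0_norm ?Kt// lam_le1.
by rewrite (bigD1 k)//= lerDl sumr_ge0.
Qed.

Lemma lam_barycenter j : j \in K ->
  lam j (#|K|%:R^-1 *: \sum_(i in K) v i) = #|K|%:R^-1.
Proof.
move=> jK; have K0 : #|K|%:R != 0 :> R.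
  by rewrite pnatr_eq0 cards_eq0; apply/set0Pn; exists j.
rewrite scaler_sumr aff_comb; last by rewrite sumr_const -[LHS]mulr_natr mulVf.
rewrite (bigD1 j)//= lamv// eqxx mulr1 big1 ?addr0// => i /andP[iK ij].
by rewrite lamv// (negbTE ij) mulr0.
Qed.

Lemma leb_simplex_gt0 : (0 < leb R n S)%E.
Proof.
apply: leb_open_gt0; first exact: open_open_simplex.
have K0 : (0 < #|K|)%N.
  rewrite lt0n cards_eq0; apply/eqP => KE.
  by have /eqP := lam1 0; rewrite KE big_set0 eq_sym oner_eq0.
exists (#|K|%:R^-1 *: \sum_(i in K) v i) => j jK.
by rewrite lam_barycenter// invr_gt0 ltr0n.
Qed.

Lemma integrable_simplex (F : n.-tuple mR -> R) (C : R) : measurable_fun S F ->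
  (forall t, S t -> `|F t| <= C) -> (leb R n).-integrable S (EFin \o F).
Proof.
move=> mF FC; apply: measurable_bounded_integrable => //.
- exact: measurable_simplex.
- exact: leb_simplex_lty.
- exists C; split; first exact: num_real.
  by move=> M CM t St; apply: le_trans (FC _ St) (ltW CM).
Qed.

Lemma rowt_homothety r (x : 'rV[R]_n) (t : n.-tuple mR) :
  rowt (homothety r (fun k => (1 - r) * x 0 k) t) = (1 - r) *: x + r *: rowt t.
Proof. by apply/rowP => k; rewrite !mxE tnth_mktuple. Qed.

Lemma lam_homothety r i j x : i \in K -> j \in K ->
  lam j ((1 - r) *: v i + r *: x) = (1 - r) * (i == j)%:R + r * lam j x.
Proof.
move=> iK jK; rewrite -(lamv iK jK) /aff mulmxDl -!scalemxAl !mxE; ring.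
Qed.

(** [leb_homothety] says that [leb R n] is [r^n] times its own pushforward, which turns the change
    of variables into integration against a pushforward. *)
Lemma integral_homothety (F : n.-tuple mR -> R) (A : set (n.-tuple mR)) r b :
  0 < r -> measurable A -> measurable_fun A F -> (forall t, A t -> 0 <= F t) ->
  (\int[leb R n]_(t in A) (F t)%:E =
   (r ^+ n)%:E * \int[leb R n]_(t in homothety r b @^-1` A) (F (homothety r b t))%:E)%E.
Proof.
move=> r0 mA mF F0.
pose nu := (measure_function_pushforward__canonical__measure_function_Measure
      (leb R n) (@measurable_homothety R n r b)).
have rn0 : 0 <= r ^+ n by rewrite exprn_ge0// ltW.
have -> : (\int[leb R n]_(t in A) (F t)%:E =
           \int[mscale (NngNum rn0) nu]_(t in A) (F t)%:E)%E.
  apply: eq_measure_integral => B mB _.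
  transitivity ((r ^+ n)%:E * leb R n (homothety r b @^-1` B))%E; last by [].
  rewrite leb_homothety// muleA -EFinM mulfV ?mul1e//.
  by rewrite lt0r_neq0// exprn_gt0.
have mF' : measurable_fun A (fun t => (F t)%:E) by exact/measurable_EFinP.
have F0' : forall t, A t -> (0 <= (F t)%:E)%E by move=> t At; rewrite lee_fin F0.
rewrite ge0_integral_mscale//; congr (_ * _)%E.
rewrite (@ge0_integral_pushforward _ _ _ _ _ _ (@measurable_homothety R n r b))//.
by move=> t; rewrite inE; exact: F0'.
Qed.

(** The integral of [lam i * G] is compared with itself through [lam i <= (1 - r) + max (lam i - (1
    - r)) 0], and [mean_power_le] concludes. The bound [C] ensures integrability. *)
Lemma integral_lam_le (i : I) (G : 'rV[R]_n -> R) (k : nat) (C : R) :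
  i \in K -> measurable_fun S (fun t => G (rowt t)) ->
  (forall x, open_simplex x -> 0 <= G x <= C) ->
  (forall r x, 0 < r < 1 -> open_simplex x ->
     G ((1 - r) *: v i + r *: x) = r ^+ k * G x) ->
  (n + k).+1%:R * integral_Rn open_simplex (fun x => lam i x * G x)
    <= integral_Rn open_simplex G.
Proof.
move=> iK mG G0C Gh.
have G0 x : open_simplex x -> 0 <= G x by move/G0C => /andP[].
have GC x : open_simplex x -> G x <= C by move/G0C => /andP[].
have lam0 x : open_simplex x -> 0 <= lam i x by move=> /(_ i iK)/ltW.
have mS := measurable_simplex.
have mlam : measurable_fun S (fun t => lam i (rowt t)).
  by apply: measurable_funTS; exact: measurable_aff.
have iG : (leb R n).-integrable S (fun t => (G (rowt t))%:E).
  apply: (@integrable_simplex (fun t => G (rowt t)) C) => // t St.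
  by rewrite ger0_norm ?GC// G0.
have iJ : (leb R n).-integrable S (fun t => (lam i (rowt t) * G (rowt t))%:E).
  apply: (@integrable_simplex (fun t => lam i (rowt t) * G (rowt t)) C).
    exact: measurable_funM.
  move=> t St; rewrite ger0_norm ?mulr_ge0 ?G0 ?lam0//.
  by rewrite (le_trans _ (GC _ St))// ler_piMl ?G0// lam_le1.
rewrite /integral_Rn; set j := Rintegral _ _ _; set I0 := Rintegral _ _ _.
have jE : j%:E = (\int[leb R n]_(t in S) (lam i (rowt t) * G (rowt t))%:E)%E.
  by rewrite fineK//; exact: integrable_fin_num.
have IE : I0%:E = (\int[leb R n]_(t in S) (G (rowt t))%:E)%E.
  by rewrite fineK//; exact: integrable_fin_num.
have j0 : 0 <= j by apply: Rintegral_ge0 => t St; rewrite mulr_ge0 ?G0 ?lam0.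
apply: mean_power_le => // r /andP[r0 r1].
rewrite -lee_fin EFinD !EFinM jE IE.
pose F t := (lam i (rowt t) - (1 - r)) * G (rowt t).
(* This is the image of the simplex under the homothety of ratio [r] centred at [v i], as [hS]
   shows. *)
pose Sr := S `&` [set t | 1 - r < lam i (rowt t)].
have mSr : measurable Sr.
  apply: measurableI => //.
  rewrite (_ : mkset _ = (fun t => lam i (rowt t)) @^-1` `]1 - r, +oo[).
    by rewrite -[X in measurable X]setTI; apply: measurable_aff.
  by apply/seteqP; split => t /=; rewrite in_itv/= andbT.
have mF : measurable_fun S F.
  apply: measurable_funM => //; apply: measurable_funB => //.
have F0 t : Sr t -> 0 <= F t.
  by move=> [St /= lt]; rewrite mulr_ge0 ?G0// subr_ge0 ltW.
have hS : homothety r (fun k => (1 - r) * v i 0 k) @^-1` Sr = S.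
  apply/seteqP; split => t.
    move=> [H1 H2] l lK; have := H1 l lK; rewrite rowt_homothety lam_homothety//.
    case: eqVneq => [<-|_]; last by rewrite mulr0 add0r pmulr_rgt0.
    move: H2; rewrite /= rowt_homothety lam_homothety// eqxx mulr1 ltrDl pmulr_rgt0//.
  move=> St; split => [l lK|] /=; rewrite rowt_homothety lam_homothety//.
    by rewrite ltr_wpDl// ?mulr_ge0 ?subr_ge0 ?(ltW r1)// mulr_gt0// St.
  by rewrite eqxx mulr1 ltrDl mulr_gt0// St.
(* The exponent collects [n] from the measure, [k] from [G], and 1 from [lam i - (1 - r)], which
   becomes [r * lam i] after the substitution. *)
have FS : ((r ^+ (n + k).+1)%:E * \int[leb R n]_(t in S) (lam i (rowt t) * G (rowt t))%:E
   = \int[leb R n]_(t in Sr) (F t)%:E)%E.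
  rewrite (@integral_homothety F Sr r (fun k => (1 - r) * v i 0 k))//; last first.
    by apply: measurable_funS mF => // t [].
  rewrite hS -addnS exprD EFinM -muleA; congr (_ * _)%E.
  rewrite -integralZl//; apply: eq_integral => t; rewrite inE => St.
  rewrite /F rowt_homothety lam_homothety// Gh ?r0// eqxx -EFinM; congr EFin.
  by rewrite exprS mulr1 addrAC subrr add0r mulrACA.
have FP : (\int[leb R n]_(t in Sr) (F t)%:E = \int[leb R n]_(t in S)
    (Num.max (lam i (rowt t) - (1 - r)) 0 * G (rowt t))%:E)%E.
  rewrite integral_mkcondr; apply: eq_integral => t; rewrite inE => St.
  rewrite patchE; case: ifPn => [|/negP]; rewrite inE /= => lt.
    by rewrite max_l// subr_ge0 ltW.
  by rewrite max_r ?mul0r// subr_le0 leNgt; exact/negP.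
rewrite FS FP -ge0_integralZl//; last 3 first.
- exact: measurable_int iG.
- by move=> t St; rewrite lee_fin G0.
- by rewrite lee_fin subr_ge0 ltW.
have mP : measurable_fun S (fun t =>
    (Num.max (lam i (rowt t) - (1 - r)) 0 * G (rowt t))%:E).
  apply/measurable_EFinP/measurable_funM => //; apply: measurable_maxr => //.
  exact: measurable_funB.
have P0 t : S t -> (0 <= (Num.max (lam i (rowt t) - (1 - r)) 0 * G (rowt t))%:E)%E.
  by move=> St; rewrite lee_fin mulr_ge0 ?G0// le_max lexx orbT.
rewrite -ge0_integralD//; last 2 first.
- by move=> t St; rewrite mule_ge0// lee_fin ?G0// subr_ge0 ltW.
- by apply: emeasurable_funM => //; exact: measurable_int iG.
apply: ge0_le_integral => //.
- by move=> t St; rewrite lee_fin mulr_ge0 ?G0 ?lam0.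
- exact: measurable_int iJ.
- apply: emeasurable_funD => //; apply: emeasurable_funM => //.
  exact: measurable_int iG.
move=> t St; rewrite -EFinM -EFinD lee_fin -mulrDl ler_wpM2r ?G0//.
by rewrite -lerBlDl le_max lexx.
Qed.

(** For [i != j], [lam j] vanishes at [v i] and so is homogeneous of degree 1 under homotheties
    centred there: this gives the factor [n + 2]. The constant 1, of degree 0, with centre [v j]
    gives the factor [n + 1]. *)
Lemma integral_lam_lam_le i j : i \in K -> j \in K -> i != j ->
  (n.+1 * n.+2)%:R * integral_Rn open_simplex (fun x => lam i x * lam j x)
    <= vol open_simplex.
Proof.
move=> iK jK ij.
have l01 l x : l \in K -> open_simplex x -> 0 <= lam l x <= 1.
  by move=> lK Kx; rewrite (ltW (Kx l lK)) lam_le1.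
have mlam l : measurable_fun S (fun t => lam l (rowt t)).
  by apply: measurable_funTS; exact: measurable_aff.
have h1 := @integral_lam_le i (lam j) 1 1 iK (mlam j) (fun x => l01 j x jK).
have h2 := @integral_lam_le j (fun=> 1) 0 1 jK.
rewrite natrM -mulrA.
apply: (@le_trans _ _ (n.+1%:R * integral_Rn open_simplex (lam j))).
  rewrite ler_wpM2l//; rewrite addn1 in h1; apply: h1 => r x _ _.
  by rewrite lam_homothety// (negbTE ij) mulr0 add0r expr1.
rewrite addn0 in h2.
have -> : vol open_simplex = integral_Rn open_simplex (fun=> 1).
  rewrite /integral_Rn Rintegral_cst ?mul1r//; exact: measurable_simplex.
have -> : integral_Rn open_simplex (lam j) =
    integral_Rn open_simplex (fun x => lam j x * 1).
  by congr integral_Rn; apply/funext => x; rewrite mulr1.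
apply: h2 => // [x _|r x _ _]; first by rewrite ler01 lexx.
by rewrite expr0 mul1r.
Qed.
End simplex.

(** * Barycentric coordinates *)

Section barycentric.
Variables (R : realType) (d : nat).

Record barycentric (I : finType) (K : {set I}) (v : I -> 'rV[R]_d)
    (p : I -> 'cV[R]_d) (c : I -> R) : Prop := Barycentric {
  bary_vertex : {in K &, forall i j, aff (p j) (c j) (v i) = (i == j)%:R};
  bary_sum1 : forall x, \sum_(j in K) aff (p j) (c j) x = 1;
  bary_comb : forall x, \sum_(j in K) aff (p j) (c j) x *: v j = x }.

(** Let [V] have the rows [(1, v i)] and [L] the columns [(c j, p j)]. Both are square because [K]
    has [d + 1] elements, and the hypothesis reads [V L = 1]. Hence [L V = 1], whose blocks are the
    two remaining identities. *)
Lemma barycentricP (I : finType) (K : {set I}) v p c : #|K| = d.+1 ->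
  {in K &, forall i j, aff (p j) (c j) (v i) = (i == j)%:R} ->
  barycentric K v p c.
Proof.
move=> cK pcv.
pose e (a : 'I_(1 + d)) : I := enum_val (cast_ord (esym cK) a).
have eK a : e a \in K by exact: enum_valP.
have e_inj : injective e by move=> a b /enum_val_inj/cast_ord_inj.
have sumE (V : nmodType) (F : I -> V) : \sum_(j in K) F j = \sum_a F (e a).
  rewrite big_enum_val (reindex (cast_ord (esym cK)))//.
  by apply: onW_bij; exists (cast_ord cK); [exact: cast_ordKV|exact: cast_ordK].
pose V : 'M[R]_(1 + d) := row_mx (const_mx 1) (\matrix_(a, k) v (e a) 0 k).
pose L : 'M[R]_(1 + d) := col_mx (\row_a c (e a)) (\matrix_(k, a) p (e a) k 0).
have VL : V *m L = 1%:M.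
  rewrite mul_row_col; apply/matrixP => a b; rewrite !mxE big_ord1 !mxE mul1r.
  rewrite -(inj_eq e_inj) -(pcv _ _ (eK a) (eK b)) /aff mxE addrC; congr (_ + _).
  by apply: eq_bigr => k _; rewrite !mxE.
have LV := mulmx1C VL.
have main x : row_mx 1%:M x *m L = \row_a aff (p (e a)) (c (e a)) x.
  rewrite mul_row_col mul1mx; apply/rowP => a; rewrite !mxE /aff !mxE addrC.
  by congr (_ + _); apply: eq_bigr => k _; rewrite !mxE.
have xE x : (\row_a aff (p (e a)) (c (e a)) x) *m V = row_mx 1%:M x.
  by rewrite -main -mulmxA LV mulmx1.
split=> // x.
  have := xE x; rewrite mul_mx_row => /eq_row_mx[/rowP/(_ 0) + _].
  rewrite mxE [X in _ = X -> _]mxE sumE /= => E; apply: etrans E.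
  by apply: eq_bigr => a _; rewrite !mxE mulr1.
have := xE x; rewrite mul_mx_row => /eq_row_mx[_ E]; rewrite sumE -[RHS]E.
apply/rowP => k; rewrite summxE mxE; apply: eq_bigr => a _.
by rewrite !mxE.
Qed.

Lemma leb_bigsetU_null (I : finType) (A : {set I})
    (F : I -> set (d.-tuple (measurableTypeR R))) :
  (forall i, i \in A -> measurable (F i) /\ leb R d (F i) = 0%E) ->
  measurable (\big[setU/set0]_(i in A) F i) /\
  leb R d (\big[setU/set0]_(i in A) F i) = 0%E.
Proof.
move=> F0; elim/big_ind: _ => [|X Y [mX X0] [mY Y0]|i]; last exact: F0.
  by split; [exact: measurable0|exact: measure0].
split; first exact: measurableU.
apply/eqP; rewrite eq_le measure_ge0 andbT.
have : (leb R d (X `|` Y) <= leb R d X + leb R d Y)%E by exact: measureU2.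
by rewrite X0 Y0 adde0.
Qed.

Lemma aff_eq0 (p : 'cV[R]_d) c : (forall x, aff p c x = 0) -> p = 0 /\ c = 0.
Proof.
move=> H; have c0 : c = 0 by have := H 0; rewrite /aff mul0mx mxE add0r.
split=> //; apply/colP => k.
have := H (delta_mx 0 k); rewrite /aff c0 addr0 -rowE.
by rewrite !mxE.
Qed.

Variables (I : finType) (K : {set I}) (v : I -> 'rV[R]_d).
Variables (p : I -> 'cV[R]_d) (c : I -> R).
Hypothesis b : barycentric K v p c.
Local Notation lam j := (aff (p j) (c j)).

(** A barycentric coordinate is 1 at its own vertex and 0 at the others, so it reads off the
    coefficient of a convex combination. Its vanishing outside [A] is what keeps distinct cells
    apart. *)
Lemma hull_aff (A : {set I}) x : A \subset K -> hull v A x ->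
  exists2 a : I -> R, (forall i, i \in A -> 0 <= a i) &
    forall j, j \in K -> lam j x = if j \in A then a j else 0.
Proof.
move=> AK [a [a0 a1 ->]]; exists a => // j jK; rewrite aff_comb//.
have E i : i \in A -> a i * lam j (v i) = if i == j then a j else 0.
  move=> iA; rewrite (bary_vertex b (fintype.subsetP AK i iA) jK).
  by case: eqP => [->|]; rewrite ?mulr1 ?mulr0.
rewrite (eq_bigr _ E) -big_mkcondr /=.
case: ifPn => jA.
  rewrite (big_pred1 j)// => i /=.
  by case: eqVneq => [->|_]; rewrite ?andbF ?jA.
rewrite big_pred0// => i.
by case: eqVneq => [->|_]; rewrite ?andbF ?(negbTE jA).
Qed.

Lemma hullP x : hull v K x <-> forall j, j \in K -> 0 <= lam j x.
Proof.
split=> [/(hull_aff (subxx K))[a a0 E] j jK|H].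
  by rewrite E// jK a0.
exists (fun j => lam j x); split=> //; first exact: (bary_sum1 b).
by rewrite (bary_comb b).
Qed.

Lemma open_simplex_hull : open_simplex K p c `<=` hull v K.
Proof. by move=> x Kx; apply/hullP => j jK; exact/ltW/Kx. Qed.

(** The whole hyperplanes carrying the faces: they are null, and off them the closed and the open
    simplex coincide. *)
Definition faces : set (d.-tuple (measurableTypeR R)) :=
  \big[setU/set0]_(j in K) [set t | lam j (rowt t) = 0].

Lemma measurable_faces : measurable faces.
Proof. by apply: bigsetU_measurable => j _; exact: measurable_aff0. Qed.

Lemma leb_faces : leb R d faces = 0%E.
Proof.
have [] // := @leb_bigsetU_null I K (fun j => [set t | lam j (rowt t) = 0]).
move=> j jK; split; first exact: measurable_aff0.
by apply: (@leb_aff0 _ _ _ _ (v j)); rewrite (bary_vertex b)// eqxx oner_eq0.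
Qed.

Lemma facesP t : faces t <-> exists2 j, j \in K & lam j (rowt t) = 0.
Proof.
rewrite /faces -bigcup_seq_cond; split=> [[j /= /andP[_ jK] j0]|[j jK j0]].
  by exists j.
by exists j => //=; rewrite mem_index_enum.
Qed.

Lemma hull_open_simplex x : hull v K x ->
  (forall j, j \in K -> lam j x != 0) -> open_simplex K p c x.
Proof.
by move=> /hullP Kx Hx j jK; rewrite lt_neqAle eq_sym Hx//; exact: Kx.
Qed.

Lemma measurable_hull : measurable (@rowt R d @^-1` hull v K).
Proof.
rewrite (_ : _ @^-1` _ = \bigcap_(j in [set` K])
    (fun t => lam j (rowt t)) @^-1` `[0, +oo[).
  apply: fin_bigcap_measurable => [|j jK]; first exact: finite_finset.
  by rewrite -[X in measurable X]setTI; apply: measurable_aff.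
apply/seteqP; split => t /=.
  by move=> /hullP H j jK; rewrite /preimage /= in_itv/= H.
by move=> H; apply/hullP => j /H; rewrite /preimage /= in_itv/= andbT.
Qed.

(** Both domains agree once the null set [faces] is removed, so the values of [F] on it, however
    irregular, do not matter. *)
Lemma integral_hull (A : set 'rV[R]_d) F : open_simplex K p c `<=` A ->
  integral_Rn (hull v K `&` A) F = integral_Rn (open_simplex K p c) F.
Proof.
move=> KA; rewrite /integral_Rn /Rintegral; congr fine.
rewrite (integral_setD_null _ _ measurable_faces leb_faces).
rewrite [RHS](integral_setD_null _ _ measurable_faces leb_faces).
congr integral; apply/seteqP; split => t [].
  move=> [Kt _] Ft; split=> //; apply: hull_open_simplex => // j jK.
  by apply/eqP => j0; apply: Ft; apply/facesP; exists j.
move=> Kt Ft; split=> //; split; last exact: KA.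
exact: open_simplex_hull.
Qed.

Lemma vol_hull : vol (hull v K) = vol (open_simplex K p c).
Proof.
have vE A : measurable (@rowt R d @^-1` A) ->
    vol A = integral_Rn A (fun=> 1).
  by move=> mA; rewrite /integral_Rn Rintegral_cst// mul1r.
rewrite !vE; [|exact: measurable_simplex|exact: measurable_hull].
by rewrite -(setIT (hull v K)) integral_hull// => x /open_simplex_hull.
Qed.
End barycentric.

(** * The finite element matrices *)

Lemma grad_aff (R : realType) (d : nat) (p : 'cV[R]_d) c (F : 'rV[R]_d -> R) A x :
  open A -> A x -> {in A, F =1 aff p c} -> grad F x = p.
Proof.
move=> oA Ax FE; apply/colP => k; rewrite mxE.
have Ex : \near x, F x = aff p c x.
  have : nbhs (x : 'rV[R]_d) A by apply: open_nbhs_nbhs.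
  by apply: filterS => y Ay; apply: FE; rewrite inE.
rewrite (near_eq_derive _ Ex) /derive; apply: lim_near_cst => //.
have affD h : aff p c (h *: delta_mx 0 k + x) - aff p c x = h * p k 0.
  rewrite /aff mulmxDl -scalemxAl -rowE.
  by move: (x *m p) => y; rewrite !mxE; ring.
near=> h; have h0 : h != 0 by near: h; exact: nbhs_dnbhs_neq.
by rewrite /= affD /GRing.scale /= mulrA mulVf// mul1r.
Unshelve. all: by end_near. Qed.

(** * Nodal basis functions and cells of the triangulation *)

Section mesh.
Variables (R : realType) (d : nat) (Omega : set 'rV[R]_d) (T : mesh R d).
Variable (phi : 'I_(nvert T) -> 'rV[R]_d -> R).
Hypotheses (oO : open Omega) (tri : triangulation Omega T).
Hypothesis (nodal : nodal_basis Omega phi).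
Local Notation I := 'I_(nvert T).

Lemma vertex_simplex (K : {set I}) i : i \in K -> simplex K (vertex T i).
Proof.
move=> iK; exists (fun j => (j == i)%:R); split=> //.
  by rewrite (bigD1 i)//= eqxx big1 ?addr0// => j /andP[_ /negbTE ->].
rewrite (bigD1 i)//= eqxx scale1r big1 ?addr0// => j /andP[_ /negbTE ->].
by rewrite scale0r.
Qed.

(** On an element the basis functions are affine with Kronecker values at its [d + 1] vertices, so
    [barycentricP] applies. Choice collects the slopes and constants of all elements. *)
Lemma barycentric_exists : exists P : {set I} -> I -> 'cV[R]_d,
  exists C : {set I} -> I -> R, forall K, K \in elements T ->
  barycentric K (vertex T) (P K) (C K) /\
  forall j x, simplex K x -> phi j x = aff (P K j) (C K j) x.
Proof.
have [_ aff_phi phi_vertex] := nodal.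
have /choice[PC PCE] : forall K : {set I}, exists pc : (I -> 'cV[R]_d) * (I -> R),
    K \in elements T -> forall j x, simplex K x -> phi j x = aff (pc.1 j) (pc.2 j) x.
  move=> K; have [KT|KT] := boolP (K \in elements T); last first.
    by exists (fun=> 0, fun=> 0).
  have /choice[pc pcE] : forall j, exists pc : 'cV[R]_d * R,
      forall x, simplex K x -> phi j x = aff pc.1 pc.2 x.
    by move=> j; have [p [c pc]] := aff_phi j K KT; exists (p, c).
  by exists (fun j => (pc j).1, fun j => (pc j).2).
exists (fun K => (PC K).1), (fun K => (PC K).2) => K KT; split; last exact: PCE.
apply: barycentricP; first exact: tri_card tri K KT.
move=> i j iK jK; rewrite -PCE//; exact: vertex_simplex.
Qed.

Variables (P : {set I} -> I -> 'cV[R]_d) (C : {set I} -> I -> R).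
Hypothesis PCbary : forall K, K \in elements T ->
  barycentric K (vertex T) (P K) (C K).
Hypothesis phiE : forall K, K \in elements T ->
  forall j x, simplex K x -> phi j x = aff (P K j) (C K j) x.

(* P and C are meant to hold the slopes and constants of the affine pieces of
   phi: on K, phi j = aff (P K j) (C K j). *)
Definition cell (K : {set I}) : set 'rV[R]_d := open_simplex K (P K) (C K).
Local Notation tcell K := (@rowt R d @^-1` cell K).

Lemma cell_simplex K : K \in elements T -> cell K `<=` simplex K.
Proof. by move=> KT; exact: open_simplex_hull (PCbary KT). Qed.

Lemma cell_Omega K : K \in elements T -> cell K `<=` Omega.
Proof.
move=> KT; apply: subset_trans (tri_interior tri KT).
rewrite -open_subsetE; first exact: cell_simplex.
exact: open_open_simplex.
Qed.

(** The affine piece vanishes at all vertices of [K], and every point of the space is an affine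
    combination of them. *)
Lemma aff_notin K j x : K \in elements T -> j \notin K -> aff (P K j) (C K j) x = 0.
Proof.
move=> KT jK; have b := PCbary KT; have [_ _ phi_vertex] := nodal.
rewrite -[x](bary_comb b) aff_comb; last exact: (bary_sum1 b).
apply: big1 => i iK; rewrite -(phiE KT j (vertex_simplex iK)).
rewrite phi_vertex; case: eqP => [ij|_]; last by rewrite mulr0.
by rewrite -ij iK in jK.
Qed.

Lemma P_notin K j : K \in elements T -> j \notin K -> P K j = 0.
Proof. by move=> KT jK; apply: (aff_eq0 (fun x => aff_notin x KT jK)).1. Qed.

Lemma phi_ge0 j x : closure Omega x -> 0 <= phi j x.
Proof.
rewrite (tri_cover tri) => -[K /= KT Kx]; rewrite (phiE KT)//.
have [jK|jK] := boolP (j \in K); last by rewrite aff_notin.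
by have /(hullP (PCbary KT)) := Kx; exact.
Qed.

Lemma phi_sum1 x : closure Omega x -> \sum_j phi j x = 1.
Proof.
rewrite (tri_cover tri) => -[K /= KT Kx].
under eq_bigr do rewrite (phiE KT)//.
rewrite (bigID (mem K)) /= [X in _ + X]big1 ?addr0; first exact: (bary_sum1 (PCbary KT)).
by move=> j jK; rewrite aff_notin.
Qed.

(** By conformity a common point lies in the simplex on [K :&: L]. A vertex of [K] missing from [L]
    would have coordinate 0 there, against positivity in the open cell; so [K] is contained in [L],
    and the cardinalities agree. *)
Lemma cell_disjoint K L x : K \in elements T -> L \in elements T ->
  cell K x -> cell L x -> K = L.
Proof.
move=> KT LT Kx Lx.
have : simplex (K :&: L) x.
  by rewrite -(tri_conforming tri KT LT); split; exact: cell_simplex.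
move=> /(hull_aff (PCbary KT) (subsetIl K L))[a _ aE].
have KL : K \subset L.
  apply/fintype.subsetP => j jK; apply/negPn/negP => jL.
  by have := Kx j jK; rewrite aE// inE jK (negbTE jL) ltxx.
apply/eqP; rewrite finset.eqEcard KL (tri_card tri LT) (tri_card tri KT) leqnn//.
Qed.

Lemma measurable_cell K : measurable (tcell K).
Proof. exact: measurable_simplex. Qed.

Lemma leb_cell_lty K : K \in elements T -> (leb R d (tcell K) < +oo)%E.
Proof. by case/PCbary => _ h1 hx; exact: (leb_simplex_lty h1 hx). Qed.

Lemma grad_cell K j x : K \in elements T -> cell K x -> grad (phi j) x = P K j.
Proof.
move=> KT Kx; apply: (@grad_aff _ _ _ (C K j) _ (cell K)) => //.
  exact: open_open_simplex.
by move=> y; rewrite inE => Ky; apply: phiE => //; exact: cell_simplex.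
Qed.

Lemma phi_cell K j x : K \in elements T -> cell K x -> phi j x = aff (P K j) (C K j) x.
Proof. by move=> KT /(cell_simplex KT); exact: phiE. Qed.

Lemma integrable_cell K (F : 'rV[R]_d -> R) M : K \in elements T ->
  measurable_fun (tcell K) (fun t => F (rowt t)) ->
  (forall x, cell K x -> `|F x| <= M) ->
  (leb R d).-integrable (tcell K) (fun t => (F (rowt t))%:E).
Proof.
case/PCbary => _ h1 hx mF FM.
by apply: (integrable_simplex h1 hx mF (C := M)) => t /FM.
Qed.

(** Off the null set [N] of hyperplanes, [Omega] is the disjoint union of the cells: the closed
    simplices cover it, and a point with no zero coordinate is in the open one. Measurability of [F]
    is required on the cells only. *)
Lemma integral_cells (F : 'rV[R]_d -> R) :
  (forall K, K \in elements T ->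
    (leb R d).-integrable (tcell K) (fun t => (F (rowt t))%:E)) ->
  integral_Rn Omega F = \sum_(K in elements T) integral_Rn (cell K) F.
Proof.
move=> iF.
pose U := \big[setU/set0]_(K <- enum (elements T)) tcell K.
have UP t : U t <-> exists2 K, K \in elements T & cell K (rowt t).
  rewrite /U -bigcup_seq; split=> [[K]|[K KT Kt]].
    by rewrite /= mem_enum => KT Kt; exists K.
  by exists K; rewrite //= mem_enum.
have [mN N0] : measurable (\big[setU/set0]_(K in elements T) faces K (P K) (C K)) /\
    leb R d (\big[setU/set0]_(K in elements T) faces K (P K) (C K)) = 0%E.
  apply: leb_bigsetU_null => K KT.
  by split; [exact: measurable_faces|exact: leb_faces (PCbary KT)].
set N := \big[setU/set0]_(K in _) _ in mN N0.
have ND K : K \in elements T -> faces K (P K) (C K) `<=` N.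
  by move=> KT; rewrite /N (bigD1 K)//=; exact: subsetUl.
have UE : @rowt R d @^-1` Omega `\` N = U `\` N.
  apply/seteqP; split => t [Ot Nt]; split=> //; last first.
    by have /UP[K KT] := Ot; exact: cell_Omega.
  have : closure Omega (rowt t) by exact: subset_closure.
  rewrite (tri_cover tri) => -[K /= KT Kt]; apply/UP; exists K => //.
  apply: (hull_open_simplex (PCbary KT) Kt) => j jK; apply/eqP => j0.
  by apply: Nt; apply: (ND K KT); apply/facesP; exists j.
have mF K : K \in elements T -> measurable_fun (tcell K) (fun t => (F (rowt t))%:E).
  by move=> /iF/measurable_int.
have [mU mUF] : measurable U /\ measurable_fun U (fun t => (F (rowt t))%:E).
  rewrite /U big_enum /=.
  elim/big_ind: _ => [|X Y [mX X0] [mY Y0]|K KT].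
  - by split; [exact: measurable0|exact: measurable_fun_set0].
  - by split; [exact: measurableU|apply/measurable_funU].
  - by split; [exact: measurable_cell|exact: mF].
have -> : integral_Rn Omega F = fine (\int[leb R d]_(t in U) (F (rowt t))%:E)%E.
  rewrite /integral_Rn /Rintegral (integral_setD_null _ _ mN N0) UE.
  by rewrite -(integral_setD_null _ _ mN N0).
rewrite integral_bigsetU_EFin//=; last 3 first.
- by move=> K; exact: measurable_cell.
- exact: enum_uniq.
- move=> K L /=; rewrite !mem_enum => KT LT [t [Kt Lt]].
  exact: (cell_disjoint KT LT Kt Lt).
rewrite big_enum /= -sum_fine// => K KT.
by apply: integrable_fin_num (iF K KT); exact: measurable_cell.
Qed.

(** * Linearity and monotonicity of integrals over a cell *)

Lemma integral_RnD K (F G : 'rV[R]_d -> R) :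
  integrable_Rn (cell K) F -> integrable_Rn (cell K) G ->
  integral_Rn (cell K) (fun x => F x + G x) =
  integral_Rn (cell K) F + integral_Rn (cell K) G.
Proof.
by move=> iF iG; rewrite /integral_Rn RintegralD//; exact: measurable_cell.
Qed.

Lemma integral_RnZ K a (F : 'rV[R]_d -> R) : integrable_Rn (cell K) F ->
  integral_Rn (cell K) (fun x => a * F x) = a * integral_Rn (cell K) F.
Proof.
by move=> iF; rewrite /integral_Rn RintegralZl//; exact: measurable_cell.
Qed.

Lemma integrable_RnD K (F G : 'rV[R]_d -> R) :
  integrable_Rn (cell K) F -> integrable_Rn (cell K) G ->
  integrable_Rn (cell K) (fun x => F x + G x).
Proof.
by move=> iF iG; apply: integrableD iF iG; exact: measurable_cell.
Qed.

Lemma integrable_RnZ K a (F : 'rV[R]_d -> R) :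
  integrable_Rn (cell K) F -> integrable_Rn (cell K) (fun x => a * F x).
Proof.
by move=> iF; apply: integrableZl iF; exact: measurable_cell.
Qed.

Lemma integrable_Rn_sum K (J : Type) (s : seq J) (F : J -> 'rV[R]_d -> R) :
  (forall j, integrable_Rn (cell K) (F j)) ->
  integrable_Rn (cell K) (fun x => \sum_(j <- s) F j x) /\
  integral_Rn (cell K) (fun x => \sum_(j <- s) F j x) =
    \sum_(j <- s) integral_Rn (cell K) (F j).
Proof.
move=> iF; elim: s => [|j s [IH1 IH2]].
  rewrite big_nil; split.
    under [X in integrable_Rn _ X]eq_fun do rewrite big_nil.
    by apply: integrable0; exact: measurable_cell.
  under [X in integral_Rn _ X]eq_fun do rewrite big_nil.
  by rewrite /integral_Rn Rintegral_cst ?mul0r//; exact: measurable_cell.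
under [X in integrable_Rn _ X]eq_fun do rewrite big_cons.
under [X in integral_Rn _ X = _]eq_fun do rewrite big_cons.
by rewrite big_cons integral_RnD ?IH2//; split=> //; exact: integrable_RnD.
Qed.

Lemma eq_integral_cell K (F G : 'rV[R]_d -> R) :
  (forall x, cell K x -> F x = G x) ->
  integral_Rn (cell K) F = integral_Rn (cell K) G.
Proof. by move=> FG; apply: eq_Rintegral => t; rewrite inE => Kt; exact: FG. Qed.

Lemma eq_integrable_cell K (F G : 'rV[R]_d -> R) :
  (forall x, cell K x -> F x = G x) ->
  integrable_Rn (cell K) F -> integrable_Rn (cell K) G.
Proof.
move=> FG; apply: eq_integrable; first exact: measurable_cell.
by move=> t; rewrite inE => Kt; rewrite FG.
Qed.

Lemma le_integral_cell K (F G : 'rV[R]_d -> R) :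
  integrable_Rn (cell K) F -> integrable_Rn (cell K) G ->
  (forall x, cell K x -> F x <= G x) ->
  integral_Rn (cell K) F <= integral_Rn (cell K) G.
Proof.
move=> iF iG FG; apply: le_Rintegral => //; first exact: measurable_cell.
by move=> t Kt; exact: FG.
Qed.

Lemma vol_cell_gt0 K : K \in elements T -> 0 < vol (cell K).
Proof.
move=> KT; have [bv b1 bx] := PCbary KT; apply: fine_gt0.
by rewrite (leb_simplex_gt0 bv b1) (leb_cell_lty KT).
Qed.

Lemma measurable_phi_cell K j : K \in elements T ->
  measurable_fun (tcell K) (fun t => phi j (rowt t)).
Proof.
move=> KT.
apply: (eq_measurable_fun (fun t => aff (P K j) (C K j) (rowt t))).
  by move=> t; rewrite inE => Kt; rewrite (phi_cell _ KT).
by apply: measurable_funTS; exact: measurable_aff.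
Qed.

Lemma cell_closure K x : K \in elements T -> cell K x -> closure Omega x.
Proof. by move=> KT /(cell_Omega KT); exact: subset_closure. Qed.

Lemma phi_le1 j x : closure Omega x -> phi j x <= 1.
Proof.
move=> Ox; rewrite -(phi_sum1 Ox) (bigD1 j)//= lerDl.
by apply: sumr_ge0 => i _; exact: phi_ge0.
Qed.

(** All coordinates of the barycentre equal [1 / (d + 1)], so it lies in the open cell, where the
    gradient is the slope. *)
Lemma elem_gradE K i : K \in elements T -> elem_grad phi K i = P K i.
Proof.
move=> KT; apply: grad_cell => // j jK.
have [bv b1 bx] := PCbary KT.
by rewrite -(tri_card tri KT) (lam_barycenter bv)// invr_gt0 ltr0n (tri_card tri KT).
Qed.

(** * Local stiffness integrals and the mesh quantity *)

Section tensor.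
Variable D : 'rV[R]_d -> 'M[R]_d.
Hypothesis Dtensor : diffusion_tensor Omega D.

Lemma integrable_tensor K k l : K \in elements T ->
  integrable_Rn (cell K) (fun x => D x k l).
Proof.
move=> KT; have [_ /(_ k l) iD _ _] := Dtensor.
apply: integrableS iD; [exact: measurable_open|exact: measurable_cell|].
by move=> t; exact: cell_Omega.
Qed.

Lemma mulmx_trE (p q : 'cV[R]_d) (A : 'M[R]_d) :
  (p^T *m A *m q) 0 0 = \sum_k \sum_l p l 0 * q k 0 * A l k.
Proof.
rewrite mxE; apply: eq_bigr => k _; rewrite mxE mulr_suml; apply: eq_bigr => l _.
by rewrite mxE mulrAC.
Qed.

(** The gradients are constant on the cell, so only the entries of [D] are integrated. The average
    taken over [simplex K] within [Omega] equals the one over the cell, and the positive volume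
    cancels. *)
Lemma integral_stiffness K i j : K \in elements T ->
  integrable_Rn (cell K) (fun x => ((grad (phi i) x)^T *m D x *m grad (phi j) x) 0 0) /\
  integral_Rn (cell K) (fun x => ((grad (phi i) x)^T *m D x *m grad (phi j) x) 0 0) =
  vol (cell K) * ((elem_grad phi K i)^T *m tensor_avg Omega D K *m elem_grad phi K j) 0 0.
Proof.
move=> KT; have b := PCbary KT.
have E x : cell K x -> \sum_k \sum_l P K i l 0 * P K j k 0 * D x l k =
    ((grad (phi i) x)^T *m D x *m grad (phi j) x) 0 0.
  by move=> Kx; rewrite !(grad_cell _ KT Kx) mulmx_trE.
have iS k := integrable_Rn_sum (index_enum _)
  (fun l => integrable_RnZ (P K i l 0 * P K j k 0) (integrable_tensor l k KT)).
have [h1 h2] := integrable_Rn_sum (index_enum _) (fun k => (iS k).1).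
split; first exact: eq_integrable_cell E h1.
rewrite -(eq_integral_cell E) h2 !elem_gradE// mulmx_trE mulr_sumr.
apply: eq_bigr => k _; rewrite (iS k).2 mulr_sumr; apply: eq_bigr => l _.
rewrite integral_RnZ; last exact: integrable_tensor.
rewrite mxE (integral_hull b); last exact: cell_Omega.
rewrite /simplex (vol_hull b) -/(cell K) mulrCA; congr (_ * _).
by rewrite mulVKf// gt_eqF// vol_cell_gt0.
Qed.

Lemma D_acute_le K i j : K \in elements T -> i \in K -> j \in K -> i != j ->
  D_acute Omega phi D <= mesh_scale Omega T *
    - ((elem_grad phi K i)^T *m tensor_avg Omega D K *m elem_grad phi K j) 0 0.
Proof.
move=> KT iK jK ij; rewrite /D_acute ler_wpM2l ?powR_ge0//.
apply: ge_inf; last by exists K, i, j.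
pose h (q : {set I} * I * I) := - ((elem_grad phi q.1.1 q.1.2)^T *m
  tensor_avg Omega D q.1.1 *m elem_grad phi q.1.1 q.2) 0 0.
(* Only finitely many triples occur, so this bounds the set below, as is required for its infimum to
   be a lower bound. *)
exists (- \sum_q `|h q|) => _ [L [k [l [_ _ _ _ ->]]]].
rewrite lerNl (bigD1 (L, k, l))//= -[leLHS]addr0 lerD//; last exact: sumr_ge0.
by rewrite /h /= -normrN ler_norm.
Qed.

Lemma vertex_closure i : closure Omega (vertex T i).
Proof.
have [K KT iK] := tri_used tri i; rewrite (tri_cover tri); exists K => //.
exact: vertex_simplex.
Qed.

(** * The reaction term and the sign properties of the system matrix *)

Section reaction.
Variables (f : R -> R) (w : 'cV[R]_(nvert T)) (tau : R).
Hypothesis react : reaction f.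
Local Notation fe := (fe_fun phi w).

Lemma fe_fun_le (z : 'cV[R]_(nvert T)) x : closure Omega x ->
  `|fe_fun phi z x| <= \sum_j `|z j 0|.
Proof.
move=> Ox; apply: le_trans (ler_norm_sum _ _ _) _; apply: ler_sum => j _.
by rewrite normrM ler_piMr// ger0_norm ?phi_le1 ?phi_ge0.
Qed.

Lemma fe_fun_cell (z : 'cV[R]_(nvert T)) K x : K \in elements T -> simplex K x ->
  fe_fun phi z x = aff (\sum_j z j 0 *: P K j) (\sum_j z j 0 * C K j) x.
Proof.
move=> KT Kx; rewrite /aff mulmx_sumr summxE -big_split /=.
by apply: eq_bigr => j _; rewrite (phiE KT)// /aff mulrDr -scalemxAr [in RHS]mxE.
Qed.

Lemma measurable_fe_fun_cell (z : 'cV[R]_(nvert T)) K : K \in elements T ->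
  measurable_fun (tcell K) (fun t => fe_fun phi z (rowt t)).
Proof.
move=> KT; apply: measurable_sum => j; apply: measurable_funM.
  exact: measurable_cst.
exact: measurable_phi_cell.
Qed.

Lemma reaction_bound : exists M, forall x, closure Omega x -> `|f (fe x)| <= M.
Proof.
have [_ _ _ /(_ (\sum_j `|w j 0|))[M HM]] := react.
by exists M => x /(fe_fun_le w)/HM[].
Qed.

(** [sup] dominates its set only if the set is bounded above, which [reaction_bound] provides. The
    point [x] supplies an element, from which nonnegativity follows. *)
Lemma max_fneg_ge x : closure Omega x ->
  - max_fneg Omega phi f w <= f (fe x) /\ 0 <= max_fneg Omega phi f w.
Proof.
move=> Ox; have [M HM] := reaction_bound.
have : `|Num.min (f (fe x)) 0| <= max_fneg Omega phi f w.
  apply: ub_le_sup; last by exists x.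
  exists M => _ [y Oy <-]; apply: le_trans (HM y Oy).
  by rewrite minEle; case: ifP; rewrite ?normr0.
move=> h; split; last exact: le_trans h.
move: h; rewrite ler_norml => /andP[h _]; apply: le_trans h _.
by rewrite ge_min lexx.
Qed.

Lemma max_fpos_ge x : closure Omega x ->
  f (fe x) <= max_fpos Omega phi f w /\ 0 <= max_fpos Omega phi f w.
Proof.
move=> Ox; have [M HM] := reaction_bound.
have : Num.max (f (fe x)) 0 <= max_fpos Omega phi f w.
  apply: ub_le_sup; last by exists x.
  exists M => _ [y Oy <-]; rewrite ge_max (le_trans (ler_norm _) (HM y Oy)).
  exact: le_trans (HM y Oy).
by rewrite ge_max => /andP[].
Qed.

Lemma integrable_mass K i j : K \in elements T ->
  integrable_Rn (cell K) (fun x => phi j x * phi i x).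
Proof.
move=> KT; apply: (@integrable_cell _ _ 1) => //.
  by apply: measurable_funM; exact: measurable_phi_cell.
move=> x /(cell_closure KT) Ox.
by rewrite normrM !ger0_norm ?phi_ge0// mulr_ile1 ?phi_ge0 ?phi_le1.
Qed.

Lemma integrable_reaction K i j : K \in elements T ->
  integrable_Rn (cell K) (fun x => f (fe x) * phi j x * phi i x).
Proof.
move=> KT; have [M HM] := reaction_bound; apply: (@integrable_cell _ _ M) => //.
  apply: measurable_funM; last exact: measurable_phi_cell.
  apply: measurable_funM; last exact: measurable_phi_cell.
  apply: measurableT_comp; last exact: measurable_fe_fun_cell.
  by have [_ cf _ _] := react; exact: continuous_measurable_fun.
move=> x /(cell_closure KT) Ox.
rewrite -mulrA !normrM (le_trans _ (HM x Ox))// ler_piMr//.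
by rewrite !ger0_norm ?phi_ge0// mulr_ile1 ?phi_ge0 ?phi_le1.
Qed.

Definition system_mx : 'M[R]_(nvert T) :=
  mass_mx Omega phi - tau *: reaction_mx Omega phi f w
    + tau *: stiffness_mx Omega phi D.

(** The integrand of the interior rows of [system_mx], which allows the signs to be studied cell by
    cell. *)
Definition system_density (i j : I) (x : 'rV[R]_d) : R :=
  phi j x * phi i x + (- tau * (f (fe x) * phi j x * phi i x) +
  tau * ((grad (phi i) x)^T *m D x *m grad (phi j) x) 0 0).

Lemma integral_system_density K i j : K \in elements T ->
  integrable_Rn (cell K) (system_density i j) /\
  integral_Rn (cell K) (system_density i j) =
    integral_Rn (cell K) (fun x => phi j x * phi i x) +
    (- tau * integral_Rn (cell K) (fun x => f (fe x) * phi j x * phi i x) +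
     tau * integral_Rn (cell K)
       (fun x => ((grad (phi i) x)^T *m D x *m grad (phi j) x) 0 0)).
Proof.
move=> KT.
have iM := integrable_mass i j KT.
have iB := integrable_RnZ (- tau) (integrable_reaction i j KT).
have iA := integrable_RnZ tau (integral_stiffness i j KT).1.
split; first exact: integrable_RnD iM (integrable_RnD iB iA).
rewrite integral_RnD ?(integral_RnD iB iA)//; last exact: integrable_RnD iB iA.
rewrite (integral_RnZ _ (integrable_reaction i j KT)).
by rewrite (integral_RnZ _ (integral_stiffness i j KT).1).
Qed.

Lemma system_mxE (i j : I) : (i < nvint T)%N ->
  system_mx i j = \sum_(K in elements T) integral_Rn (cell K) (system_density i j).
Proof.
move=> iT; rewrite !mxE iT !integral_cells; last 3 first.
- by move=> K KT; exact: (integral_stiffness i j KT).1.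
- by move=> K KT; exact: integrable_reaction.
- by move=> K KT; exact: integrable_mass.
rewrite -mulNr !mulr_sumr -addrA -!big_split /=; apply: eq_bigr => K KT.
by rewrite (integral_system_density i j KT).2.
Qed.

Let c : R := (d.+1 * d.+2)%:R.

Lemma integral_mass_le K i j : K \in elements T -> i \in K -> j \in K -> i != j ->
  c * integral_Rn (cell K) (fun x => phi j x * phi i x) <= vol (cell K).
Proof.
move=> KT iK jK ij; have [bv b1 bx] := PCbary KT.
rewrite (eq_integral_cell (G := fun x => aff (P K j) (C K j) x * aff (P K i) (C K i) x)).
  by apply: (integral_lam_lam_le bv b1 bx) => //; rewrite eq_sym.
by move=> x Kx; rewrite !(phi_cell _ KT Kx).
Qed.

Hypothesis tau0 : 0 < tau.
Let s := mesh_scale Omega T.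
Let fneg := max_fneg Omega phi f w.
Let fpos := max_fpos Omega phi f w.
Let Dac := D_acute Omega phi D.

(** Each element contributes at most 0. With [V] the volume of the cell, the mass and reaction parts
    are at most [(1 + tau * fneg) * V / c] and the diffusion part at most [- tau * V * Dac / s]; the
    hypothesis on [tau] says that these add up to at most 0. *)
Lemma system_mx_le0 (i j : I) : (i < nvint T)%N -> i != j ->
  0 < s -> s <= tau * (c * Dac - s * fneg) -> system_mx i j <= 0.
Proof.
move=> iT ij s0 Htau; rewrite system_mxE//; apply: sumr_le0 => K KT.
rewrite (integral_system_density i j KT).2.
(* If one of the two vertices is not in [K], its basis function and gradient vanish on the cell, and
   so do all three integrals. *)
have [iK|iK] := boolP (i \in K); last first.
  have E x : cell K x -> phi i x = 0.
    by move=> Kx; rewrite (phi_cell _ KT Kx) aff_notin.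
  rewrite (eq_integral_cell (G := fun=> 0)); last by move=> x /E ->; rewrite mulr0.
  rewrite [X in - tau * X](eq_integral_cell (G := fun=> 0)); last first.
    by move=> x /E ->; rewrite mulr0.
  rewrite (integral_stiffness i j KT).2 elem_gradE// P_notin// trmx0 !mul0mx mxE.
  rewrite /integral_Rn Rintegral_cst; last exact: measurable_cell.
  by rewrite !mul0r !mulr0 !addr0.
have [jK|jK] := boolP (j \in K); last first.
  have E x : cell K x -> phi j x = 0.
    by move=> Kx; rewrite (phi_cell _ KT Kx) aff_notin.
  rewrite (eq_integral_cell (G := fun=> 0)); last by move=> x /E ->; rewrite mul0r.
  rewrite [X in - tau * X](eq_integral_cell (G := fun=> 0)); last first.
    by move=> x /E ->; rewrite mulr0 mul0r.
  rewrite (integral_stiffness i j KT).2 (elem_gradE j KT) (P_notin KT jK) mulmx0 mxE.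
  rewrite /integral_Rn Rintegral_cst; last exact: measurable_cell.
  by rewrite !mul0r !mulr0 !addr0.
have := D_acute_le KT iK jK ij; rewrite -/Dac -/s (integral_stiffness i j KT).2.
set e := (_ *m _) 0 0 => De.
have := integral_mass_le KT iK jK ij.
set m := integral_Rn _ _ => mV; set b := integral_Rn _ _.
have bm : - fneg * m <= b.
  rewrite /m -integral_RnZ; last exact: integrable_mass.
  apply: le_integral_cell.
  - exact/integrable_RnZ/integrable_mass.
  - exact: integrable_reaction.
  - move=> x /(cell_closure KT) Ox; rewrite -[leRHS]mulrA ler_wpM2r//.
      by rewrite mulr_ge0 ?phi_ge0.
    by have [] := max_fneg_ge Ox.
have m0 : 0 <= m.
  apply: Rintegral_ge0 => t /(cell_closure KT) Ox.
  by rewrite mulr_ge0 ?phi_ge0.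
have V0 := vol_cell_gt0 KT; set V := vol _ in V0 mV *.
have c0 : 0 < c by rewrite ltr0n.
have neg0 : 0 <= fneg.
  by have [_] := max_fneg_ge (@vertex_closure i).
(* Scaling by [c * s > 0] frees the bounds [h1] and [h2] of divisions; [h3] is the time step
   condition times [V]. *)
have : c * s * (m + (- tau * b + tau * (V * e))) <= 0; last first.
  by rewrite pmulr_rle0// mulr_gt0.
have h1 : c * s * (m - tau * b) <= s * (1 + tau * fneg) * V.
  apply: (@le_trans _ _ (s * (1 + tau * fneg) * (c * m))); last first.
    by rewrite ler_wpM2l// mulr_ge0 ?(ltW s0)// addr_ge0// mulr_ge0// ltW.
  have : 0 <= c * s * tau * (b - - fneg * m).
    by rewrite mulr_ge0 ?subr_ge0// !mulr_ge0 ?ltW.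
  by rewrite mulNr opprK; lra.
have h2 : c * s * (tau * (V * e)) <= - (tau * V * c * Dac).
  have : 0 <= tau * V * c * (s * - e - Dac).
    by rewrite mulr_ge0 ?subr_ge0// !mulr_ge0 ?ltW.
  by lra.
have h3 : 0 <= V * (tau * (c * Dac - s * fneg) - s).
  by rewrite mulr_ge0 ?subr_ge0// ltW.
lra.
Qed.

(** If the integral were 0, the function would vanish almost everywhere on the cell. The cell would
    then lie in the union of a null set and a null hyperplane, against its positive measure. *)
Lemma integral_sqr_aff_gt0 K (p : 'cV[R]_d) a x : K \in elements T -> aff p a x != 0 ->
  integrable_Rn (cell K) (fun y => aff p a y ^+ 2) ->
  0 < integral_Rn (cell K) (fun y => aff p a y ^+ 2).
Proof.
move=> KT px iF; have ge0 : 0 <= integral_Rn (cell K) (fun y => aff p a y ^+ 2).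
  by apply: Rintegral_ge0 => t _; exact: sqr_ge0.
rewrite lt_neqAle ge0 andbT; apply/eqP => /esym H0.
have mF : measurable_fun (tcell K) (fun t => ((aff p a (rowt t)) ^+ 2)%:E).
  exact: measurable_int iF.
have : (\int[leb R d]_(t in tcell K) `|((aff p a (rowt t)) ^+ 2)%:E| = 0)%E.
  under eq_integral do rewrite gee0_abs ?lee_fin ?sqr_ge0//.
  rewrite -[LHS]fineK; first by rewrite [X in X%:E]H0.
  by apply: integrable_fin_num iF; exact: measurable_cell.
move=> /(ae_eq_integral_abs _ (measurable_cell K) mF)[N [mN N0 NP]].
have [bv b1 bx] := PCbary KT; have := leb_simplex_gt0 bv b1.
rewrite lt_neqAle => /andP[/eqP + _]; apply; apply/esym/eqP.
rewrite eq_le measure_ge0 andbT.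
have mZ := measurable_aff0 p a.
apply: (@le_trans _ _ (leb R d (N `|` [set t | aff p a (rowt t) = 0]))).
  apply: le_measure; rewrite ?inE; [exact: measurable_cell|exact: measurableU|].
  move=> t Kt; have [Nt|Nt] := pselect (N t); [by left|right => /=].
  apply/eqP; rewrite -sqrf_eq0; apply/eqP; apply: contrapT => pt.
  by apply: Nt; apply: NP => /= /(_ Kt)[].
have : (leb R d (N `|` [set t | aff p a (rowt t) = 0%R]) <=
  leb R d N + leb R d [set t | aff p a (rowt t) = 0%R])%E by exact: measureU2.
by rewrite N0 (leb_aff0 px) adde0.
Qed.

(** The density is bilinear in the pair of basis functions, so the double sum collapses to its value
    on the finite element function of [z]. *)
Lemma system_density_form (z : 'cV[R]_(nvert T)) x :
  \sum_i \sum_j z i 0 * z j 0 * system_density i j x =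
  (1 - tau * f (fe x)) * fe_fun phi z x ^+ 2 +
  tau * ((\sum_i z i 0 *: grad (phi i) x)^T *m D x *m
         (\sum_i z i 0 *: grad (phi i) x)) 0 0.
Proof.
have -> : (\sum_i z i 0 *: grad (phi i) x)^T *m D x *m
    (\sum_i z i 0 *: grad (phi i) x) =
    \sum_i \sum_j (z i 0 * z j 0) *: ((grad (phi i) x)^T *m D x *m grad (phi j) x).
  rewrite [X in X *m _ *m _]linear_sum !mulmx_suml; apply: eq_bigr => i _.
  rewrite mulmx_sumr; apply: eq_bigr => j _.
  by rewrite [X in X *m _ *m _]linearZ /= -!scalemxAl -scalemxAr scalerA.
rewrite summxE mulr_sumr expr2 /fe_fun big_distrlr /= mulr_sumr -big_split /=.
apply: eq_bigr => i _; rewrite summxE !mulr_sumr -big_split /=.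
apply: eq_bigr => j _; rewrite /system_density [in RHS]mxE -/(fe_fun phi w x).
by ring.
Qed.

Lemma integrable_fe_sqr (z : 'cV[R]_(nvert T)) K : K \in elements T ->
  integrable_Rn (cell K) (fun x => fe_fun phi z x ^+ 2).
Proof.
move=> KT; apply: (@integrable_cell _ _ ((\sum_j `|z j 0|) ^+ 2)) => //.
  by apply: measurable_funX; exact: measurable_fe_fun_cell.
move=> x /(cell_closure KT)/(fe_fun_le z) zx.
by rewrite normrX lerXn2r ?nnegrE// sumr_ge0.
Qed.

(** The diffusion part is nonnegative by ellipticity and is dropped; in the rest [f] is bounded
    above by [fpos]. *)
Lemma system_form_cell (z : 'cV[R]_(nvert T)) K : K \in elements T ->
  (1 - tau * fpos) * integral_Rn (cell K) (fun x => fe_fun phi z x ^+ 2) <=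
  \sum_i \sum_j z i 0 * z j 0 * integral_Rn (cell K) (system_density i j).
Proof.
move=> KT.
have iS i := integrable_Rn_sum (index_enum _)
  (fun j => integrable_RnZ (z i 0 * z j 0) (integral_system_density i j KT).1).
have [h1 h2] := integrable_Rn_sum (index_enum _) (fun i => (iS i).1).
have -> : \sum_i \sum_j z i 0 * z j 0 * integral_Rn (cell K) (system_density i j) =
    integral_Rn (cell K) (fun x => \sum_i \sum_j z i 0 * z j 0 * system_density i j x).
  rewrite h2; apply: eq_bigr => i _; rewrite (iS i).2; apply: eq_bigr => j _.
  by rewrite integral_RnZ//; exact: (integral_system_density i j KT).1.
rewrite -integral_RnZ; last exact: integrable_fe_sqr.
apply: le_integral_cell => //; first exact/integrable_RnZ/integrable_fe_sqr.
move=> x Kx; rewrite system_density_form.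
have [_ _ _ [alpha alpha0 Dpos]] := Dtensor.
apply: (@le_trans _ _ ((1 - tau * f (fe x)) * fe_fun phi z x ^+ 2)).
  rewrite ler_wpM2r ?sqr_ge0// lerD2l lerN2 ler_pM2l//.
  by have [] := max_fpos_ge (cell_closure KT Kx).
rewrite lerDl mulr_ge0 ?(ltW tau0)//.
apply: le_trans (Dpos _ (cell_Omega KT Kx) _).
rewrite mulr_ge0 ?(ltW alpha0)// mxE sumr_ge0// => k _.
by rewrite mxE -expr2 sqr_ge0.
Qed.

(** Every element contributes a nonnegative amount. An element [K0] around a vertex with
    [z i0 0 != 0] contributes a positive one, since the affine piece of [fe_fun phi z] on it is
    nonzero at that vertex. *)
Lemma system_form_gt0 (z : 'cV[R]_(nvert T)) : 0 < 1 - tau * fpos ->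
  (forall i, z i 0 != 0 -> (i < nvint T)%N) -> z != 0 ->
  0 < \sum_i \sum_j z i 0 * z j 0 * system_mx i j.
Proof.
move=> del0 zint /cV0Pn[i0 zi0].
have -> : \sum_i \sum_j z i 0 * z j 0 * system_mx i j =
    \sum_(K in elements T) \sum_i \sum_j z i 0 * z j 0 *
      integral_Rn (cell K) (system_density i j).
  rewrite [RHS]exchange_big; apply: eq_bigr => i _; rewrite [RHS]exchange_big.
  apply: eq_bigr => j _; rewrite -mulr_sumr.
  (* Only the interior rows are integrals of the density; [z] vanishes on the others. *)
  have [->|/zint iT] := eqVneq (z i 0) 0; first by rewrite !mul0r.
  by rewrite system_mxE.
apply: (@lt_le_trans _ _ (\sum_(K in elements T)
    (1 - tau * fpos) * integral_Rn (cell K) (fun x => fe_fun phi z x ^+ 2))).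
  have [K0 K0T iK0] := tri_used tri i0.
  have sq0 K : 0 <=
      (1 - tau * fpos) * integral_Rn (cell K) (fun x => fe_fun phi z x ^+ 2).
    by rewrite mulr_ge0 ?(ltW del0)//; apply: Rintegral_ge0 => t _; exact: sqr_ge0.
  rewrite (bigD1 K0)//= ltr_pwDl//; last by apply: sumr_ge0 => K _; exact: sq0.
  rewrite mulr_gt0//.
  have E x : cell K0 x -> fe_fun phi z x ^+ 2 =
      aff (\sum_j z j 0 *: P K0 j) (\sum_j z j 0 * C K0 j) x ^+ 2.
    by move=> /(cell_simplex K0T) Kx; rewrite (fe_fun_cell _ K0T).
  rewrite (eq_integral_cell E).
  apply: (@integral_sqr_aff_gt0 _ _ _ (vertex T i0)) => //.
    rewrite -(fe_fun_cell _ K0T); last exact: vertex_simplex.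
    have [_ _ phi_vertex] := nodal.
    rewrite /fe_fun (bigD1 i0)//= phi_vertex eqxx mulr1 big1 ?addr0// => j ji.
    by rewrite phi_vertex eq_sym (negbTE ji) mulr0.
  exact: eq_integrable_cell E (integrable_fe_sqr z K0T).
by apply: ler_sum => K KT; exact: system_form_cell.
Qed.

End reaction.
End tensor.
End mesh.

(** * Nonnegativity *)

Lemma stieltjes_ge0 (R : realDomainType) n (A : 'M[R]_n) (w : 'cV[R]_n) (S : pred 'I_n) :
  (forall i, S i -> 0 <= (A *m w) i 0) -> (forall i, ~~ S i -> 0 <= w i 0) ->
  (forall i j, S i -> i != j -> A i j <= 0) ->
  (forall z : 'cV[R]_n, (forall i, z i 0 != 0 -> S i) -> z != 0 ->
    0 < \sum_i \sum_j z i 0 * z j 0 * A i j) ->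
  forall i, 0 <= w i 0.
Proof.
move=> Aw w0 Aoff Apos.
pose z : 'cV[R]_n := \col_i Num.min (w i 0) 0.
have zE i : z i 0 = Num.min (w i 0) 0 by rewrite mxE.
have z_le0 i : z i 0 <= 0 by rewrite zE ge_min lexx orbT.
have z_le i : z i 0 <= w i 0 by rewrite zE ge_min lexx.
have zS i : z i 0 != 0 -> S i.
  by apply: contraNT => /w0 wi; rewrite zE min_r.
have zw i : z i 0 * (w i 0 - z i 0) = 0.
  rewrite zE minEle; case: ifP => _; first by rewrite subrr mulr0.
  by rewrite mul0r.
have [z0|zn0] := eqVneq z 0.
  by move=> i; have := z_le i; rewrite z0 mxE.
have := Apos z zS zn0.
have : \sum_i z i 0 * (A *m w) i 0 <= 0.
  apply: sumr_le0 => i _; have [->|/zS/Aw] := eqVneq (z i 0) 0.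
    by rewrite mul0r.
  exact: mulr_le0_ge0.
suff : \sum_i \sum_j z i 0 * z j 0 * A i j <= \sum_i z i 0 * (A *m w) i 0.
  by move=> h1 h2 h3; have := lt_le_trans h3 (le_trans h1 h2); rewrite ltxx.
apply: ler_sum => i _; rewrite [(A *m w) i 0]mxE mulr_sumr; apply: ler_sum => j _.
(* This difference is 0 on the diagonal, where [z i 0] or [w i 0 - z i 0] is 0. Off the diagonal it
   is the product of [A i j <= 0] and a nonpositive factor. *)
rewrite -subr_ge0 (_ : _ - _ = A i j * (z i 0 * (w j 0 - z j 0))); last by ring.
have [<-|ij] := eqVneq i j; first by rewrite zw mulr0.
have [->|/zS Si] := eqVneq (z i 0) 0; first by rewrite mul0r mulr0.
rewrite mulr_le0// ?Aoff// mulr_le0_ge0// subr_ge0//.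
Qed.

Theorem theorem3p3 (R : realType) (d : nat) (Omega : set 'rV[R]_d) (Tend : R)
  (D : 'rV[R]_d -> 'M[R]_d) (f : R -> R)
  (u0 : 'rV[R]_d -> R) (g : 'rV[R]_d -> R -> R)
  (T : mesh R d) (phi : 'I_(nvert T) -> 'rV[R]_d -> R)
  (N : nat) (t : nat -> R) (u : nat -> 'cV[R]_(nvert T))
  (dt := fun n : nat => t n.+1 - t n)
  (s := mesh_scale Omega T)
  (c := (d.+1 * d.+2)%:R : R)
  (Dac := D_acute Omega phi D)
  (fneg := fun n : nat => max_fneg Omega phi f (u n))
  (fpos := fun n : nat => max_fpos Omega phi f (u n)) :
  (1 <= d <= 3)%N ->
  polyhedral_domain Omega ->
  0 < Tend ->
  diffusion_tensor Omega D ->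
  reaction f ->
  triangulation Omega T ->
  nodal_basis Omega phi ->
  t 0%N = 0 -> (forall n, (n < N)%N -> t n < t n.+1) -> t N <= Tend ->
  (forall x, closure Omega x -> 0 <= u0 x) ->
  (forall x r, boundary Omega x -> 0 < r <= Tend -> 0 <= g x r) ->
  (forall j, u 0%N j 0 = u0 (vertex T j)) ->
  (forall n, (n < N)%N ->
    (mass_mx Omega phi - dt n *: reaction_mx Omega phi f (u n)
       + dt n *: stiffness_mx Omega phi D) *m u n.+1
    = mass_mx Omega phi *m u n + dt n *: boundary_vec T g (t n.+1)) ->
  (forall n, (n < N)%N -> Dac > s * (fneg n / c)) ->
  (forall n, (n < N)%N ->
    (s%:E / (c * Dac - s * fneg n)%:E <= (dt n)%:E)%E /\
    ((dt n)%:E < 1 / (fpos n)%:E)%E) ->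
  forall n, (n <= N)%N ->
    (forall j, 0 <= u n j 0) /\
    (forall x, Omega x -> 0 <= fe_fun phi (u n) x).
Proof.
move=> _ [oO _ _ _ _] _ Dtensor react tri nodal t0 tS tN u0_ge0 g_ge0 u0E scheme Dacn dtn.
have closE i : closure Omega (vertex T i) := @vertex_closure _ _ _ _ tri i.
have [P [C PC]] := barycentric_exists tri nodal.
have PCbary K KT := (PC K KT).1.
have phiE K KT := (PC K KT).2.
have phi0 j x : closure Omega x -> 0 <= phi j x by exact: (phi_ge0 tri nodal PCbary phiE).
have tpos n : (n <= N)%N -> 0 <= t n.
  elim: n => [|n IH nN]; first by rewrite t0.
  by rewrite (le_trans (IH (ltnW nN)))// ltW// tS.
(* Induction downwards from [N], carried by [N - n]: the sign of [g] is known only for times up to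
   [Tend]. *)
have tTend n : (n <= N)%N -> t n <= Tend.
  move=> nN; apply: le_trans tN; rewrite -{1}(subKn nN).
  elim: (N - n)%N (leq_subr n N) => [|k IH] kN; first by rewrite subn0.
  apply: le_trans (IH (ltnW kN)); rewrite -(subnSK kN) ltW// tS//.
  by rewrite subnSK ?leq_subr.
suff uge0 n : (n <= N)%N -> forall j, 0 <= u n j 0.
  move=> n nN; split=> [|x /subset_closure Ox]; first exact: uge0.
  by apply: sumr_ge0 => j _; rewrite mulr_ge0 ?uge0 ?phi0.
elim: n => [|n IH] nN; first by move=> j; rewrite u0E u0_ge0.
have {}IH := IH (ltnW nN).
have dt0 : 0 < dt n by rewrite subr_gt0 tS.
have c0 : 0 < c by rewrite ltr0n.
have den0 : 0 < c * Dac - s * fneg n.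
  by rewrite subr_gt0 -ltr_pdivrMl// mulrC -mulrA Dacn.
(* [Dac] has [s] as a factor, so [s = 0] would turn the mesh condition into [0 > 0]. *)
have s0 : 0 < s.
  rewrite lt_neqAle powR_ge0 andbT; apply/eqP => sE.
  by have := Dacn n nN; rewrite /Dac /D_acute -/s -sE !mul0r ltxx.
have [dt_ge dt_lt] := dtn n nN.
have {}dt_ge : s <= dt n * (c * Dac - s * fneg n).
  by move: dt_ge; rewrite inver gt_eqF// -EFinM lee_fin ler_pdivrMr.
(* The index [i] supplies a point of the closure, which gives [0 <= fpos n]. If [fpos n] is 0, the
   upper bound on the time step is infinite and the claim is [0 < 1]. *)
have {}dt_lt (i : 'I_(nvert T)) : 0 < 1 - dt n * fpos n.
  have [_ fp0] := max_fpos_ge tri nodal PCbary phiE (u n) react (@closE i).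
  move: dt_lt; rewrite div1e inver; case: eqP => [->|/eqP fpn0].
    by rewrite mulr0 subr0 ltr01.
  have fpgt0 : 0 < fpos n by rewrite lt_neqAle eq_sym fpn0.
  by rewrite lte_fin -[_^-1]mul1r ltr_pdivlMr// subr_gt0.
have row (i : 'I_(nvert T)) : (system_mx Omega phi D f (u n) (dt n) *m u n.+1) i 0 =
    (mass_mx Omega phi *m u n) i 0 + dt n * boundary_vec T g (t n.+1) i 0.
  by rewrite scheme// [LHS]mxE; congr (_ + _); rewrite mxE.
apply: (@stieltjes_ge0 _ _ (system_mx Omega phi D f (u n) (dt n)) _
  (fun i => (i < nvint T)%N)).
- move=> i iT; rewrite row [boundary_vec _ _ _ _ _]mxE iT mulr0 addr0 mxE.
  apply: sumr_ge0 => j _; rewrite mulr_ge0// mxE iT.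
  by apply: Rintegral_ge0 => x /subset_closure Ox; rewrite mulr_ge0 ?phi0.
(* In a boundary row mass and reaction vanish and the stiffness row is that of the identity, so the
   equation reads [dt * u = dt * g] and [dt] cancels. *)
- move=> i iT.
  have := row i; rewrite [boundary_vec _ _ _ _ _]mxE (negbTE iT).
  rewrite [X in X = _]mxE [X in _ = X + _]mxE.
  rewrite (bigD1 i)//= [X in _ + X]big1; last first.
    by move=> j ji; rewrite !mxE (negbTE iT) eq_sym (negbTE ji) !mulr0 !subr0 addr0 mul0r.
  rewrite [X in _ = X + _]big1; last by move=> j _; rewrite mxE (negbTE iT) mul0r.
  rewrite !mxE (negbTE iT) eqxx mulr0 subr0 add0r mulr1 addr0 add0r.
  move=> /(mulfI (lt0r_neq0 dt0)) ->; apply: g_ge0.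
    apply: contrapT => /(tri_numbering tri i).2; exact/negP.
  by rewrite tTend// (le_lt_trans (tpos n (ltnW nN)))// tS.
- move=> i j iT ij.
  exact: (system_mx_le0 oO tri nodal PCbary phiE Dtensor react dt0 iT ij s0 dt_ge).
(* A nonzero entry of [z] provides the vertex that [dt_lt] asks for. *)
- move=> z zT zn0; have /cV0Pn[i _] := zn0.
  exact: (system_form_gt0 oO tri nodal PCbary phiE Dtensor react dt0 (dt_lt i) zT zn0).
Qed.
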